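(* Let $\mathcal{H}(g,t,f,e,n,D)$ be the set of sequenced orientable hypermaps of genus $g$ with $t$ darts, $f$ faces and $e$ hyperedges, with the root vertex of degree $n$ and with the list of degrees of the distinguished vertices equal to $D=(d_1,d_2,\dots,d_{|D|})$, where $d_i$ is the degree of the distinguished vertex with label $i$. The set $\mathcal{H}(g,t,f,e,n,D)$ satisfies the bijective decomposition $$\mathcal{H}(g,t,f,e,n,D)=\sum_{\substack{g_1+g_2=g\\ t_1+t_2=t-1\\ f_1+e_2=e\\ f_2+e_1=f\\ n_1+n_2=n-1\\ D_1\subseteq D}} \mathcal{H}(g_1,t_1,f_1,e_1,n_1,D_1)\times \mathcal{H}(g_2,t_2,f_2,e_2,n_2,D-D_1)$$ $$+\ \sum_{p=1}^{n-2}\mathcal{H}(g-1,t-1,e,f,n-1-p,p.D)\times\{1,\dots,p\}\ +\ \sum_{p=n}^{t-1}\mathcal{H}(g,t-1,e,f,p,D)$$ $$+\ \sum_{j=1}^{|D|}\mathcal{H}(g,t-1,e,f,d_j+n-1,D-\{d_j\})\ +\ \Delta_{(g,t,f,e,n,D)=(0,0,1,0,0,[\,])},$$ where $+$ and $\sum$ denote disjoint union of sets and the equality sign stands for a bijection between the two sides.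
   Context: A (combinatorial) hypermap is a triple $(\Omega,R,L)$ where $\Omega$ is a finite set of darts and $R,L$ are permutations of $\Omega$ such that the group $\langle R,L\rangle$ acts transitively on $\Omega$. The orbits of $R$, $L$ and $RL$ ($L$ followed by $R$) are the vertices, hyperedges and faces; the degree of a vertex is the number of darts in it. The genus $g$ of a hypermap with $t$ darts, $v$ vertices, $e$ hyperedges and $f$ faces is given by $v+e+f=t+2(1-g)$. By convention there is also a unique empty hypermap (no darts), with $v=f=1$ and $g=e=0$; its single vertex has degree $0$. A rooted hypermap is the empty hypermap or a nonempty hypermap with a distinguished dart, the root; the root vertex is the vertex containing the root (for the empty hypermap, its only vertex). A sequenced (rooted) hypermap is a rooted hypermap in which some vertices other than the root vertex (possibly none) are distinguished and labelled $1,\dots,k$, where $k$ is the number of distinguished vertices. Sequenced hypermaps are considered up to isomorphism (bijections of darts commuting with $R$ and $L$ and preserving the root and the labelled distinguished vertices). In $\mathcal{H}(g,t,f,e,n,D)$ the third argument is the number of faces and the fourth is the number of hyperedges; these two arguments are interchanged in several terms. List conventions: $D_1\subseteq D$ means that $D_1$ is a sublist of $D$, sublists being counted with multiplicity (so that e.g. $[1]$ occurs twice as a sublist of $[1,1,2]$), and $D-D_1$ is the complementary sublist; $D-\{d_j\}$ is $D$ with its $j$-th element removed; $p.D$ is $D$ with $p$ put in front; $[\,]$ is the empty list. A disjoint union over an empty range is the empty set, and sets $\mathcal{H}(\dots)$ with a negative parameter are empty. $\Delta_\varphi$ is the singleton containing the empty hypermap if $\varphi$ is true and the empty set otherwise.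
   Formalization: When t>0, the root degree n and all degrees d_i in D are assumed positive, as degrees in a nonempty hypermap are; otherwise the formula fails, e.g. H(0,1,0,1,0,[]) is empty but the third sum contains H(0,0,1,0,0,[]), the empty hypermap. *)

(* Defs.v *)
From mathcomp Require Import all_boot all_order all_algebra all_fingroup.

Set Implicit Arguments.
Unset Strict Implicit.
Unset Printing Implicit Defensive.

Import Order.TTheory GRing.Theory Num.Theory.

Local Open Scope ring_scope.

(* [transitive _, on S | _] requires S to be nonempty, so a [hypermap] has at
   least one dart; the empty hypermap is a constructor of [seq_hypermap]. *)
Record hypermap := Hypermap {
  dart :> finType;
  Rperm : {perm dart};
  Lperm : {perm dart};
  hypermap_trans :
    [transitive <<[set Rperm; Lperm]>>%g, on [set: dart] | 'P]
}.

Definition vertices (h : hypermap) : {set {set h}} := porbits (Rperm h).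

Definition hyperedges (h : hypermap) : {set {set h}} := porbits (Lperm h).

(* (s * t)%g x = t (s x), so this is L followed by R. *)
Definition faces (h : hypermap) : {set {set h}} :=
  porbits (Lperm h * Rperm h)%g.

(* A nonempty sequenced hypermap; the vertex at position i of [marked] is the
   distinguished vertex with label i + 1. *)
Record marked_hypermap := MarkedHypermap {
  base :> hypermap;
  root : base;
  marked : seq {set base};
  marked_uniq : uniq marked;
  marked_vertices : {subset marked <= vertices base};
  root_unmarked : porbit (Rperm base) root \notin marked
}.

Inductive seq_hypermap :=
  | EmptyHypermap
  | NonemptyHypermap of marked_hypermap.

Definition ndarts (s : seq_hypermap) : nat :=
  if s is NonemptyHypermap h then #|dart h| else 0.

Definition nvertices (s : seq_hypermap) : nat :=
  if s is NonemptyHypermap h then #|vertices h| else 1.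

Definition nhyperedges (s : seq_hypermap) : nat :=
  if s is NonemptyHypermap h then #|hyperedges h| else 0.

Definition nfaces (s : seq_hypermap) : nat :=
  if s is NonemptyHypermap h then #|faces h| else 1.

Definition root_degree (s : seq_hypermap) : nat :=
  if s is NonemptyHypermap h then #|porbit (Rperm h) (root h)| else 0.

Definition marked_degrees (s : seq_hypermap) : seq nat :=
  if s is NonemptyHypermap h then [seq #|(V : {set h})| | V <- marked h]
  else [::].

Definition has_genus (s : seq_hypermap) (g : int) : Prop :=
  (nvertices s)%:Z + (nhyperedges s)%:Z + (nfaces s)%:Z
    = (ndarts s)%:Z + 2 * (1 - g).

Definition marked_iso (h1 h2 : marked_hypermap) : Prop :=
  exists phi : h1 -> h2,
    [/\ bijective phi,
        forall x, phi (Rperm h1 x) = Rperm h2 (phi x),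
        forall x, phi (Lperm h1 x) = Lperm h2 (phi x),
        phi (root h1) = root h2
      & [seq (phi @: (V : {set h1}))%SET | V <- marked h1] = marked h2].

Definition seq_iso (s1 s2 : seq_hypermap) : Prop :=
  match s1, s2 with
  | EmptyHypermap, EmptyHypermap => True
  | NonemptyHypermap h1, NonemptyHypermap h2 => marked_iso h1 h2
  | _, _ => False
  end.

(* Plain predicates, because the universe of the library's classical [set] is
   below that of finType. *)
Definition hypermap_class : Type := seq_hypermap -> Prop.

Definition iso_class (s : seq_hypermap) : hypermap_class :=
  fun s' => seq_iso s s'.

(* The parameters are integers, so that subtraction is not truncated. The set
   is empty when one of them is negative: this is imposed for g and automatic
   for the others, which are cardinals. *)
Definition hypermaps (g t f e n : int) (D : seq int) : Type :=
  {C : hypermap_class | exists s : seq_hypermap,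
     C = iso_class s /\
     [/\ 0 <= g /\ has_genus s g,
         (ndarts s)%:Z = t,
         (nfaces s)%:Z = f /\ (nhyperedges s)%:Z = e,
         (root_degree s)%:Z = n
       & [seq d%:Z | d <- marked_degrees s] = D]}.

Definition Delta (P : Prop) : Type :=
  {C : hypermap_class | C = iso_class EmptyHypermap /\ P}.

Definition int_range (a b : int) : Type := {p : int | a <= p <= b}.

Record splitting (g t f e n : int) := Splitting {
  g1 : int; g2 : int;
  t1 : int; t2 : int;
  f1 : int; f2 : int;
  e1 : int; e2 : int;
  n1 : int; n2 : int;
  split_g : g1 + g2 = g;
  split_t : t1 + t2 = t - 1;
  split_e : f1 + e2 = e;
  split_f : f2 + e1 = f;
  split_n : n1 + n2 = n - 1
}.

(* The sublists of D, with multiplicity, are the [mask m D] for m a list of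
   booleans of the same length. *)
Definition co_mask (T : Type) (m : bitseq) (D : seq T) : seq T :=
  mask (map negb m) D.

Definition remove_nth (T : Type) (j : nat) (D : seq T) : seq T :=
  take j D ++ drop j.+1 D.

Definition decomposition (g t f e n : int) (D : seq int) : Type :=
  ({s : splitting g t f e n & {m : (size D).-tuple bool &
      hypermaps (g1 s) (t1 s) (f1 s) (e1 s) (n1 s) (mask m D)
      * hypermaps (g2 s) (t2 s) (f2 s) (e2 s) (n2 s) (co_mask m D)}}
   + {p : int_range 1 (n - 2) &
      hypermaps (g - 1) (t - 1) e f (n - 1 - sval p) (sval p :: D)
      * int_range 1 (sval p)}
   + {p : int_range n (t - 1) & hypermaps g (t - 1) e f (sval p) D}
   + {j : 'I_(size D) &
      hypermaps g (t - 1) e f (D`_j + n - 1) (remove_nth j D)}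
   + Delta ((g, t, f, e, n, D) = (0, 0, 1, 0, 0, [::])))%type.

(* Main.v *)
Require Import Defs.
From mathcomp Require Import all_boot all_order all_algebra.
From mathcomp Require Import all_fingroup zify.
From Stdlib Require Import FunctionalExtensionality PropExtensionality.
From Stdlib Require Import ProofIrrelevance IndefiniteDescription.

(** Write r for the root of a nonempty hypermap, L for its hyperedge
    permutation, F for its face permutation (L followed by R), and put a = L r,
    b = F r. Bypassing r in its L-cycle and in its F-cycle gives permutations A
    and B fixing r, with L = A * tperm r a and F = B * tperm r b in the
    left-to-right product of permutations. So (L, F, r) carries the same
    information as (A, B, a, b, r), where a and b are arbitrary darts, possibly
    r itself. On the other darts A and B define at most two hypermaps, the
    component of a and the component of b, since every dart of a transitive
    hypermap is joined to r through a or through b. The vertex permutation of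
    the smaller object is R0 = A^-1 * B.

    The component of a is read with the vertex permutation R0^-1 and the
    hyperedge permutation B, which makes A its face permutation: hyperedges and
    faces are interchanged there. The component of b is read with R0 and A, and
    its face permutation is B. This is the interchange of the third and fourth
    arguments in the decomposition. When a = r or b = r, the corresponding
    component is empty, and the single vertex and face of the empty hypermap make
    the counts come out right.

    The cases of the decomposition are then as follows.
    - a and b lie in different components (or one of them is r): two hypermaps
      rooted at a and b; the root vertex is the union of their root vertices
      and of r, and the mask records which distinguished vertices belong to the
      component of a ([splits]).
    - a and b are in one component but in different R0-cycles: one hypermap
      rooted at a, in which the cycle of b becomes the first distinguished
      vertex; the position of b in it is the factor {1, ..., p}
      ([splits_vertex]).
    - b = R0^-k a for some k smaller than the degree p of the R0-cycle of a:
      this cycle consists of the root vertex without r, and of the vertex of a,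
      which has degree k + 1. Hence n = p - k determines k when the vertex of a
      is not distinguished ([merges_unmarked]), and d_j = k + 1 determines it
      when the vertex of a is the distinguished vertex j ([merges_marked]).

    The genus adds up because [porbits_mul_tperm] computes the number of cycles
    of a product with a transposition. In the second case one must know that a
    smaller hypermap of genus g - 1 exists only if g - 1 is nonnegative; that the
    genus of any hypermap is a natural number is proved by induction, with the
    decomposition itself ([genus_exists]).

    Rather than constructing hypermaps by functions, each case is a relation
    between a hypermap and its pieces: it is isomorphic to the hypermap glued
    from the pieces on the type option (X1 + X2), None being the root. These
    relations are invariant under isomorphism, determine the hypermap from the
    pieces and the pieces from the hypermap (up to isomorphism), exclude one
    another, and cover all hypermaps. They therefore induce a bijection between
    the isomorphism classes on both sides. *)

Set Implicit Arguments.
Unset Strict Implicit.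
Unset Printing Implicit Defensive.

Import GRing.Theory.

Local Notation NE := NonemptyHypermap.
Local Notation EE := EmptyHypermap.

(** * Cycles of a permutation bypassing a point *)

Section Porbits.

Variables (T : finType) (s : {perm T}).

Lemma porbit_next x y : (s y \in porbit s x) = (y \in porbit s x).
Proof.
by rewrite -!eq_porbit_mem -[s y]/(iter 1 s y) -permX porbit_perm.
Qed.

Lemma porbit_ind x (P : T -> Prop) :
  P x -> (forall y, y \in porbit s x -> P y -> P (s y)) ->
  forall y, y \in porbit s x -> P y.
Proof.
move=> Px Ps y /porbitP[i ->]; rewrite permX; elim: i => [|i IHi] //=.
by apply: Ps; rewrite // -permX mem_porbit.
Qed.

Lemma porbit_fixed x : s x = x -> porbit s x = [set x].
Proof.
move=> sx; apply/setP=> y; rewrite inE; apply/idP/eqP=> [|->]; last first.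
  exact: porbit_id.
by move: y; apply: porbit_ind => // z _ ->.
Qed.

Lemma porbit_iter_inj x i j : i < #|porbit s x| -> j < #|porbit s x| ->
  iter i s x = iter j s x -> i = j.
Proof.
move=> ltim ltjm; have := uniq_traject_porbit s x.
set m := #|_| in ltim ltjm * => Um eqij; apply/eqP.
by rewrite -(nth_uniq x _ _ Um) ?size_traject // !nth_traject ?eqij.
Qed.

Lemma porbit_iterP x y :
  reflect (exists2 i, i < #|porbit s x| & y = iter i s x) (y \in porbit s x).
Proof. by rewrite porbit_traject; apply: trajectP. Qed.

End Porbits.

Lemma imset_porbit (T T' : finType) (s : {perm T}) (s' : {perm T'})
    (j : T -> T') :
  (forall x, j (s x) = s' (j x)) ->
  forall x, (j @: porbit s x)%SET = porbit s' (j x).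
Proof.
move=> js x; have jX i y : j ((s ^+ i)%g y) = (s' ^+ i)%g (j y).
  by rewrite !permX; elim: i => //= i <-.
apply/setP=> z; apply/imsetP/porbitP => [[y /porbitP[i ->] ->]|[i ->]].
  by exists i.
by exists ((s ^+ i)%g x); rewrite ?mem_porbit ?jX.
Qed.

Lemma porbit_agree (T : finType) (s s' : {perm T}) x :
  (forall y, y \in porbit s x -> s' y = s y) -> porbit s' x = porbit s x.
Proof.
move=> ss'; have ssX i : (s' ^+ i)%g x = (s ^+ i)%g x.
  rewrite !permX; elim: i => //= i ->; apply: ss'.
  by rewrite -permX mem_porbit.
by apply/setP=> y; apply/porbitP/porbitP => -[i ->]; exists i.
Qed.

(** Since r is fixed by A, multiplying by the transposition inserts r into the
    cycle of a. *)
Lemma card_porbits_insert (T : finType) (A : {perm T}) (r a : T) : A r = r ->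
  #|porbits (A * tperm r a)%g| + (a != r) = #|porbits A|.
Proof.
move=> Ar; have /= := porbits_mul_tperm A^-1 r a.
have -> : (tperm r a * A^-1 = (A * tperm r a)^-1)%g by rewrite invMg tpermV.
rewrite !porbitsV porbitV porbit_sym porbit_fixed // inE (eq_sym r a).
by case: (a == r) => /=; lia.
Qed.

Lemma tperm_closed (T : finType) (S : {set T}) x y z :
  x \in S -> y \in S -> z \in S -> tperm x y z \in S.
Proof. by move=> xS yS zS; case: tpermP. Qed.

(** The vertex permutations R of a hypermap and R0 of what is left without its
    root r, in terms of the bypassed permutations A and B and of the images a and
    b of r under L and F. *)
Section Frame.

Variables (T : finType) (r a b : T) (A B : {perm T}).
Hypotheses (Ar : A r = r) (Br : B r = r).

Let R0 := (A^-1 * B)%g.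
Let L := (A * tperm r a)%g.
Let F := (B * tperm r b)%g.
Let R := (L^-1 * F)%g.

(** The only darts whose cycle differs between R0 and R. *)
Definition touched : {set T} := r |: (porbit R0 a :|: porbit R0 b).

Let RE x : R x = tperm r b (R0 (tperm r a x)).
Proof. by rewrite /R /L /F /R0 invMg tpermV !permM. Qed.

Let R0r : R0 r = r.
Proof. by rewrite permM -{1}Ar permK. Qed.

Let R0_neq_r x : x != r -> R0 x != r.
Proof. by rewrite -{2}R0r (inj_eq perm_inj). Qed.

Lemma frame_porbit_root : porbit R0 r = [set r].
Proof. exact: porbit_fixed. Qed.

Let porbit_neq_r x y : x != r -> y \in porbit R0 x -> y != r.
Proof.
move=> xr yx; apply: contraNneq xr => yr; move: yx.
by rewrite yr porbit_sym frame_porbit_root inE.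
Qed.

Lemma frame_last : R a = b.
Proof. by rewrite RE tpermR R0r tpermL. Qed.

Lemma frame_root : R r = tperm r b (R0 a).
Proof. by rewrite RE tpermL. Qed.

Lemma frame_generic x : x != r -> x != a -> R0 x != b -> R x = R0 x.
Proof.
move=> xr xa xb; rewrite RE (tpermD (z := x)) 1?eq_sym //.
by rewrite tpermD // eq_sym // R0_neq_r.
Qed.

Let touched_r : r \in touched. Proof. by rewrite !inE eqxx. Qed.
Let touched_a : a \in touched. Proof. by rewrite !inE porbit_id orbT. Qed.
Let touched_b : b \in touched. Proof. by rewrite !inE porbit_id !orbT. Qed.

Let touched_R0 x : x \in touched -> R0 x \in touched.
Proof.
rewrite !inE; case/or3P=> [/eqP->|xa|xb]; first by rewrite R0r eqxx.
  by rewrite (porbit_next R0 a) xa !orbT.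
by rewrite (porbit_next R0 b) xb !orbT.
Qed.

Let touched_R x : x \in touched -> R x \in touched.
Proof. by move=> xU; rewrite RE tperm_closed // touched_R0 // tperm_closed. Qed.

Let porbit_touched x y : x \in touched -> y \in porbit R x -> y \in touched.
Proof. by move=> xU; move: y; apply: porbit_ind => // z _; apply: touched_R. Qed.

Lemma porbit_untouched x : x \notin touched -> porbit R x = porbit R0 x.
Proof.
move=> xU; apply: porbit_agree => y yx.
have mem_yx c : (y \in porbit R0 c) = (x \in porbit R0 c).
  by move: yx; rewrite -!eq_porbit_mem => /eqP->.
have yU : y \notin touched.
  move: xU; rewrite !inE !mem_yx; suff -> : (y == r) = (x == r) by [].
  by have := mem_yx r; rewrite frame_porbit_root !inE.
apply: frame_generic.
- by apply: contraNneq yU => ->.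
- by apply: contraNneq yU => ->.
apply: contra yU => /eqP yb; rewrite !inE -(porbit_next R0 b) yb.
by rewrite porbit_id !orbT.
Qed.

(** If a and b lie in different R0-cycles, R runs from r through the cycle of a,
    ending at a, then from b through the cycle of b, and back to r. The degenerate
    cases a = r and b = r just omit a cycle, which is why the hypothesis is only
    made for a different from r. *)
Section Joined.

Hypotheses (ab : a != r -> b \notin porbit R0 a).
Let ba : b != r -> a \notin porbit R0 b.
Proof.
case: (eqVneq a r) => [->|ar br]; last by rewrite porbit_sym ab.
by rewrite porbit_sym frame_porbit_root inE.
Qed.

Lemma porbit_root_joined : porbit R r = touched.
Proof.
apply/eqP; rewrite eqEsubset; apply/andP; split.
  by apply/subsetP=> y; apply: porbit_touched.
(* R leaves r for R0 a and agrees with R0 until it reaches a. *)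
have Aa : porbit R0 a \subset porbit R r.
  have [->|ar] := eqVneq a r.
    by rewrite frame_porbit_root sub1set porbit_id.
  have R0a : R0 a != b.
    by apply: contraNneq (ab ar) => <-; rewrite porbit_next porbit_id.
  have Ra : R0 a \in porbit R r.
    rewrite -(_ : R r = R0 a) ?porbit_next ?porbit_id //.
    by rewrite frame_root tpermD // eq_sym ?R0_neq_r.
  have -> : porbit R0 a = porbit R0 (R0 a).
    by apply/eqP; rewrite eq_porbit_mem porbit_sym porbit_next porbit_id.
  apply/subsetP; apply: porbit_ind => // y yRa yr.
  have ya : y \in porbit R0 a.
    by rewrite -eq_porbit_mem -[R0 a]/((R0 ^+ 1)%g a) porbit_perm 
               eq_porbit_mem in yRa.
  have [->|ya'] := eqVneq y a; first by [].
  rewrite -frame_generic ?porbit_next //; first exact: porbit_neq_r ya.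
  by apply: contraNneq (ab ar) => <-; rewrite porbit_next.
have br : b \in porbit R r.
  by rewrite -frame_last porbit_next; apply: (subsetP Aa); apply: porbit_id.
rewrite !subUset sub1set porbit_id Aa /=.
have [->|br'] := eqVneq b r.
  by rewrite frame_porbit_root sub1set porbit_id.
apply/subsetP; apply: porbit_ind => // y yb yr.
have [->|yb'] := eqVneq (R0 y) b; first by [].
rewrite -frame_generic ?porbit_next //; first exact: porbit_neq_r yb.
by apply: contraTneq yb => ->; apply: ba.
Qed.

Lemma card_touched_joined :
  #|touched| = (#|porbit R0 a :\ r| + #|porbit R0 b :\ r|).+1.
Proof.
rewrite (cardsD1 r) touched_r /= add1n; congr _.+1.
rewrite -cardsUI -[LHS]addn0; congr (_ + _).
  by apply: eq_card => x; rewrite !inE; case: eqVneq.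
apply/esym/eqP; rewrite cards_eq0; apply/eqP/setP=> x; rewrite !inE.
apply/negP=> /andP[/andP[xr xa] /andP[_ xb]].
have ar : a != r.
  by apply: contraNneq xr => ar; rewrite ar frame_porbit_root inE in xa.
case/negP: (ab ar); rewrite -eq_porbit_mem eq_sym.
by rewrite -eq_porbit_mem in xa; rewrite -(eqP xa) eq_porbit_mem.
Qed.

End Joined.

(** If a and b lie in the same R0-cycle, R closes its segment from b to a into a
    cycle, and closes the segment that remains by means of r. *)
Section Cut.

Variable k : nat.
Hypotheses (ar : a != r) (km : k < #|porbit R0 b|) (ka : iter k R0 b = a).

Let m := #|porbit R0 b|.
Let br : b != r.
Proof.
apply: contraNneq ar => br; move: km ka.
by rewrite br frame_porbit_root cards1; case: k => // _ /= <-.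
Qed.

Let ab : porbit R0 a = porbit R0 b.
Proof. by rewrite -ka -permX porbit_perm. Qed.

Let iter_neq_r i : iter i R0 b != r.
Proof. by rewrite (porbit_neq_r br) // -permX mem_porbit. Qed.

Let iter_neq_b i : i.+1 < m -> R0 (iter i R0 b) != b.
Proof.
move=> im; apply/eqP; rewrite -iterS => /(@porbit_iter_inj _ _ _ _ 0).
by move/(_ im (leq_ltn_trans (leq0n _) im)).
Qed.

Let R_iter i : i <= k -> iter i R b = iter i R0 b.
Proof.
elim: i => //= i IHi ik; rewrite {}IHi 1?ltnW // frame_generic //.
  apply/eqP; rewrite -ka => /porbit_iter_inj -/(_ (ltn_trans ik km) km) eik.
  by rewrite eik ltnn in ik.
by apply: iter_neq_b; apply: leq_ltn_trans km.
Qed.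

Lemma porbit_last_cut x :
  reflect (exists2 i, i <= k & x = iter i R0 b) (x \in porbit R a).
Proof.
have aR : iter k R b = a by rewrite R_iter.
apply: (iffP idP) => [|[i ik ->]]; last first.
  by rewrite -aR -R_iter // -permX -[in porbit _ _]permX porbit_perm mem_porbit.
move: x; apply: porbit_ind => [|y _ [i ik ->]]; first by exists k.
have [->|nik] := eqVneq i k; first by exists 0; rewrite // ka frame_last.
have ik' : i < k by rewrite ltn_neqAle nik.
by exists i.+1; rewrite // -(R_iter ik') -(R_iter ik).
Qed.

Lemma card_porbit_last_cut : #|porbit R a| = k.+1.
Proof.
have Uc : uniq (traject R0 b k.+1).
  by have := uniq_traject_porbit R0 b; rewrite -(take_traject _ _ km);
     apply: take_uniq.
rewrite -[RHS](size_traject R0 b) -(card_uniqP Uc); apply: eq_card => x.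
by apply/porbit_last_cut/trajectP.
Qed.

Lemma root_notin_last_cut : r \notin porbit R a.
Proof. by apply/porbit_last_cut=> -[i _]; apply/eqP; rewrite eq_sym. Qed.

Let Rr_iter i : k < i < m -> iter i R0 b \in porbit R r.
Proof.
elim: i => // i IHi /andP[ki im].
have Rr := porbit_id R r; have [eik|nik] := eqVneq i k.
  rewrite iterS eik ka -(_ : R r = R0 a) ?porbit_next // frame_root tpermD //.
    by rewrite eq_sym R0_neq_r.
  by rewrite -ka eq_sym iter_neq_b // -eik.
have ki' : k < i by rewrite ltn_neqAle eq_sym nik -ltnS.
rewrite iterS -frame_generic ?porbit_next ?IHi ?ki' ?(ltnW im) ?iter_neq_b //.
apply/eqP; rewrite -ka => /porbit_iter_inj -/(_ (ltnW im) km) eik.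
by rewrite eik eqxx in nik.
Qed.

Lemma touched_cut : touched = porbit R r :|: porbit R a.
Proof.
apply/setP=> x; apply/idP/idP; last first.
  by case/setUP; apply: porbit_touched.
rewrite !inE ab orbb => /predU1P[->|/porbit_iterP[i im ->]].
  by rewrite porbit_id.
case: (leqP i k) => ik; last by rewrite Rr_iter // ik.
by rewrite orbC; apply/orP; left; apply/porbit_last_cut; exists i.
Qed.

Lemma card_porbit_root_cut : #|porbit R r| = #|porbit R0 a| - k.
Proof.
have U1 : #|touched| = m.+1.
  rewrite cardsU1 ab setUid; suff -> : r \notin porbit R0 b by [].
  by apply/negP=> /(porbit_neq_r br); rewrite eqxx.
move: U1; rewrite touched_cut cardsU card_porbit_last_cut.
suff -> : porbit R r :&: porbit R a = set0 by rewrite cards0 ab -/m; lia.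
apply/setP=> x; rewrite !inE; apply/negP=> /andP[]; rewrite porbit_sym.
rewrite -!eq_porbit_mem => /eqP <-; rewrite eq_porbit_mem.
exact/negP/root_notin_last_cut.
Qed.

End Cut.

End Frame.

(** R is obtained from R0 by multiplication with two transpositions. The second
    one may join or cut; comparing R with tperm r a * R instead of the reverse
    makes the criterion a condition on the cycles of R itself. *)
Lemma card_vertices_frame (T : finType) (r a b : T) (A B : {perm T}) :
  A r = r -> B r = r ->
  let R0 := (A^-1 * B)%g in
  let R := ((A * tperm r a)^-1 * (B * tperm r b))%g in
  #|porbits R| + (a != r) + (b != r) =
  #|porbits R0| + (r \notin porbit R a).*2.
Proof.
move=> Ar Br R0 R; pose R1 := (R0 * tperm r b)%g.
have R0r : R0 r = r by rewrite permM -{1}Ar permK.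
have e1 : #|porbits R1| + (b != r) = #|porbits R0|.
  by apply: card_porbits_insert.
have /= := porbits_mul_tperm R r a.
have -> : (tperm r a * R = R1)%g.
  by rewrite /R /R1 /R0 invMg tpermV !mulgA tperm2 mul1g.
by rewrite -e1 (eq_sym r a) => <-; rewrite addnAC.
Qed.

(** * Components, and embeddings of a rooted hypermap into permutations *)

Section Orbits.

Variables (T : finType) (P Q : {perm T}).

Definition component (x : T) : {set T} := orbit 'P <<[set P; Q]>>%g x.

Lemma component_id x : x \in component x.
Proof. exact: orbit_refl. Qed.

Lemma component_P x y : y \in component x -> P y \in component x.
Proof.
move=> yx; apply: orbit_trans yx; apply/orbitP; exists P => //.
by apply: mem_gen; rewrite !inE eqxx.
Qed.

Lemma component_Q x y : y \in component x -> Q y \in component x.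
Proof.
move=> yx; apply: orbit_trans yx; apply/orbitP; exists Q => //.
by apply: mem_gen; rewrite !inE eqxx orbT.
Qed.

Lemma component_ind (Pr : T -> Prop) x :
  Pr x -> (forall y, y \in component x -> Pr y -> Pr (P y)) ->
  (forall y, y \in component x -> Pr y -> Pr (Q y)) ->
  forall y, y \in component x -> Pr y.
Proof.
move=> Px PP PQ y /orbitP[g /gen_prodgP[n [c cPQ ->]] <-] /=.
suff [] : (aperm x (\prod_i c i)%g \in component x) /\ Pr (aperm x (\prod_i c i)%g) by [].
elim: n c cPQ => [|n IHn] c cPQ.
  by rewrite big_ord0 /aperm perm1 component_id.
rewrite big_ord_recr /= /aperm permM -/(aperm x _).
have [|IH1 IH2] := IHn (fun i => c (widen_ord (leqnSn n) i)).
  by move=> i; apply: cPQ.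
have /set2P[->|->] := cPQ ord_max.
  by split; [apply: component_P | apply: PP].
by split; [apply: component_Q | apply: PQ].
Qed.

(** Applied to the component of x, which is closed under P and Q. *)
Lemma transitive_closed x :
  (forall S : {set T}, x \in S -> (forall y, y \in S -> P y \in S) ->
     (forall y, y \in S -> Q y \in S) -> forall y, y \in S) ->
  [transitive <<[set P; Q]>>%g, on [set: T] | 'P].
Proof.
move=> Sfull; apply/imsetP; exists x; rewrite ?inE //.
apply/esym/eqP; rewrite eqEsubset subsetT; apply/subsetP=> y _.
apply: (Sfull (component x) (component_id x)); first exact: component_P.
exact: component_Q.
Qed.

End Orbits.

(** Transitivity as an induction principle: any dart is reached from x by applying
    the two permutations, without their inverses. *)
Lemma dart_ind (h : hypermap) (x : h) (Pr : h -> Prop) :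
  Pr x -> (forall y, Pr y -> Pr (Rperm h y)) ->
  (forall y, Pr y -> Pr (Lperm h y)) -> forall y, Pr y.
Proof.
move=> Px PR PL y; have := atransP (hypermap_trans h) x (in_setT x).
move/setP/(_ y); rewrite inE => yx.
by apply: (component_ind Px _ _ yx) => z _; [apply: PR | apply: PL].
Qed.

Definition push (X Y : finType) (f : X -> Y) (ms : seq {set X}) :
    seq {set Y} :=
  [seq (f @: (V : {set X}))%SET | V <- ms].

Section Push.

Variables X Y Z : finType.

Lemma push_comp (g : Y -> Z) (f : X -> Y) ms :
  push (g \o f) ms = push g (push f ms).
Proof. by rewrite /push -map_comp; apply: eq_map => V; apply: imset_comp. Qed.

Lemma eq_push (f g : X -> Y) : f =1 g -> push f =1 push g.
Proof. by move=> fg ms; apply: eq_map => V; apply: eq_imset. Qed.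

Lemma push_inj (f : X -> Y) : injective f -> injective (push f).
Proof. by move=> /imset_inj; apply: inj_map. Qed.

End Push.

Lemma push_id (X : finType) (f : X -> X) : f =1 id -> push f =1 id.
Proof.
move=> fid ms; rewrite (eq_push fid) /push -[RHS]map_id; apply: eq_map => V.
exact: imset_id.
Qed.

(** The empty hypermap is seen as a hypermap on the empty type without root, so
    that most arguments apply to it without case distinction. *)
Definition darts (s : seq_hypermap) : finType :=
  if s is NonemptyHypermap h then dart h else void.

Definition sR (s : seq_hypermap) : {perm darts s} :=
  if s is NonemptyHypermap h then Rperm h else 1%g.

Definition sL (s : seq_hypermap) : {perm darts s} :=
  if s is NonemptyHypermap h then Lperm h else 1%g.

Definition sF (s : seq_hypermap) : {perm darts s} := (sL s * sR s)%g.

Definition sroot (s : seq_hypermap) : option (darts s) :=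
  if s is NonemptyHypermap h then Some (Defs.root h) else None.

Definition smarked (s : seq_hypermap) : seq {set darts s} :=
  if s is NonemptyHypermap h then marked h else [::].

Lemma seq_dart_ind (s : seq_hypermap) (Pr : darts s -> Prop) :
  (forall x, sroot s = Some x -> Pr x) ->
  (forall y, Pr y -> Pr (sR s y)) -> (forall y, Pr y -> Pr (sL s y)) ->
  forall y, Pr y.
Proof.
case: s Pr => [|h] Pr /= Px PR PL; first by case.
by apply: (dart_ind (x := Defs.root h)) => //; apply: Px.
Qed.

(** Isomorphisms without the condition on distinguished vertices. *)
Definition seq_morph (s s' : seq_hypermap) (phi : darts s -> darts s') :=
  [/\ bijective phi, forall x, phi (sR s x) = sR s' (phi x),
      forall x, phi (sL s x) = sL s' (phi x)
    & omap phi (sroot s) = sroot s'].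

Lemma seq_isoP s s' :
  seq_iso s s' <->
  exists2 phi, @seq_morph s s' phi & push phi (smarked s) = smarked s'.
Proof.
case: s s' => [|h] [|h'] /=; split=> //.
- by move=> _; exists id => //; split=> //; exists id.
- by case=> phi [].
- by case=> phi [].
- by case=> phi [bij pR pL pr pm]; exists phi => //; split=> //=; rewrite pr.
by case=> phi [bij pR pL [pr]] pm; exists phi.
Qed.

Lemma seq_morph_id s : @seq_morph s s id.
Proof. by split=> //; [exists id | case: (sroot s)]. Qed.

Lemma seq_morph_comp s s' s'' phi psi :
  @seq_morph s s' phi -> @seq_morph s' s'' psi -> @seq_morph s s'' (psi \o phi).
Proof.
move=> [bf fR fL fr] [bg glueR glueL gr]; split.
- exact: bij_comp.
- by move=> x /=; rewrite fR glueR.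
- by move=> x /=; rewrite fL glueL.
by rewrite -gr -fr; case: (sroot s).
Qed.

Lemma seq_morph_inv s s' phi psi :
  @seq_morph s s' phi -> cancel phi psi -> cancel psi phi ->
  @seq_morph s' s psi.
Proof.
move=> [bf fR fL fr] fK gK; split; first by exists phi.
- by move=> x; rewrite -{1}(gK x) -fR fK.
- by move=> x; rewrite -{1}(gK x) -fL fK.
by rewrite -fr; case: (sroot s) => //= x; rewrite fK.
Qed.

Lemma seq_iso_refl s : seq_iso s s.
Proof.
by apply/seq_isoP; exists id; [apply: seq_morph_id | apply: push_id].
Qed.

Lemma seq_iso_sym s s' : seq_iso s s' -> seq_iso s' s.
Proof.
move/seq_isoP=> [phi mphi pm]; have [[psi fK gK] _ _ _] := mphi.
apply/seq_isoP; exists psi; first exact: seq_morph_inv mphi fK gK.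
by rewrite -pm -push_comp push_id.
Qed.

Lemma seq_iso_trans s s' s'' : seq_iso s s' -> seq_iso s' s'' -> seq_iso s s''.
Proof.
move=> /seq_isoP[phi mphi pm] /seq_isoP[psi mpsi pm'].
apply/seq_isoP; exists (psi \o phi); first exact: seq_morph_comp.
by rewrite push_comp pm.
Qed.

(** An equivariant embedding j of s into T, where P and Q extend the permutations of s.
    The point r stands for the missing root of the empty hypermap, so that x = r
    means that s is empty. *)
Definition placed (s : seq_hypermap) (T : finType) (P Q : {perm T}) (r x : T)
    (j : darts s -> T) : Prop :=
  [/\ injective j, forall u, j u != r,
      forall u, j (sR s u) = P (j u), forall u, j (sL s u) = Q (j u)
    & oapp j r (sroot s) = x].

Lemma placed_sub s s' (T : finType) P Q (r x : T) (j : darts s -> T) (j' : darts s' -> T) :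
  placed P Q r x j -> placed P Q r x j' -> forall u, exists v, j u = j' v.
Proof.
move=> [_ jr jR jL jx] [_ _ jR' jL' jx']; apply: seq_dart_ind.
- move=> y ry; rewrite ry /= in jx; have := jr y; rewrite jx -jx'.
  by case: (sroot s') => /= [z _|/eqP//]; exists z.
- by move=> y [v yv]; exists (sR s' v); rewrite jR jR' yv.
by move=> y [v yv]; exists (sL s' v); rewrite jL jL' yv.
Qed.

(** The image of a placement is generated by x, so both placements have the same
    image and differ by an isomorphism. This rigidity of rooted hypermaps is what
    makes the pieces of a decomposition unique. *)
Lemma placed_uniq s s' (T : finType) P Q (r x : T) (j : darts s -> T) (j' : darts s' -> T) :
  placed P Q r x j -> placed P Q r x j' ->
  exists2 phi, @seq_morph s s' phi & forall u, j u = j' (phi u).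
Proof.
move=> pj pj'; have /fin_all_exists[phi jphi] := placed_sub pj pj'.
have /fin_all_exists[psi jpsi] := placed_sub pj' pj.
have [ji jr jR jL jx] := pj; have [ji' jr' jR' jL' jx'] := pj'.
exists phi => //; split.
- by exists psi => u; [apply: ji | apply: ji']; rewrite -?jpsi -?jphi.
- by move=> u; apply: ji'; rewrite -jphi jR jphi jR'.
- by move=> u; apply: ji'; rewrite -jphi jL jphi jL'.
move: jx'; rewrite -jx; case: (sroot s) => [u|]; case: (sroot s') => [v|] //=.
- by rewrite jphi => /ji' ->.
- by move/esym/eqP; rewrite (negPf (jr _)).
by move/eqP; rewrite (negPf (jr' _)).
Qed.

(** The hypermap induced by P and Q on the component of x. *)
Section Restriction.

Variables (T : finType) (P Q : {perm T}) (x : T).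

Let X : finType := {y | y \in component P Q x}.

Let restr (S : {perm T}) (S_in : forall y, y \in component P Q x ->
    S y \in component P Q x) (u : X) : X := Sub (S (val u)) (S_in _ (valP u)).

Let restr_inj S S_in : injective (@restr S S_in).
Proof. by move=> u v /(congr1 val) /perm_inj/val_inj. Qed.

Let PX := perm (@restr_inj P (@component_P _ P Q x)).
Let QX := perm (@restr_inj Q (@component_Q _ P Q x)).

Let PX_val u : val (PX u) = P (val u). Proof. by rewrite permE. Qed.
Let QX_val u : val (QX u) = Q (val u). Proof. by rewrite permE. Qed.

Let rX : X := Sub x (component_id P Q x).

Let trans_X : [transitive <<[set PX; QX]>>%g, on [set: X] | 'P].
Proof.
apply: (@transitive_closed _ _ _ rX) => S Sx SP SQ [y yx].
pose Pr y := forall yx : y \in component P Q x, (exist _ y yx : X) \in S.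
apply: (component_ind (Pr := Pr) _ _ _ yx) => [{}yx|{yx}y yx IHy yx'|{yx}y yx IHy yx'].
- by rewrite (_ : (exist _ x yx : X) = rX) //; apply: val_inj.
- rewrite (_ : (exist _ (P y) yx' : X) = PX (Sub y yx : X)) ?SP ?IHy //.
  by apply: val_inj; rewrite PX_val.
rewrite (_ : (exist _ (Q y) yx' : X) = QX (Sub y yx : X)) ?SQ ?IHy //.
by apply: val_inj; rewrite QX_val.
Qed.

Variable ms : seq {set T}.
Hypotheses (Ums : uniq ms) (ms_x : porbit P x \notin ms)
  (ms_P : forall V, V \in ms -> exists2 y, y \in component P Q x & V = porbit P y).

Lemma component_placed : exists (h : marked_hypermap) (j : h -> T),
  [/\ injective j, forall u, j (Rperm h u) = P (j u),
      forall u, j (Lperm h u) = Q (j u), j (Defs.root h) = x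
    & push j (marked h) = ms] /\
  forall y, y \in component P Q x -> exists u, j u = y.
Proof.
pose h := Hypermap trans_X; pose pull (V : {set T}) : {set h} := [set u : X | val u \in V].
have pullK V : V \in ms -> (val @: pull V)%SET = V.
  move/ms_P=> [y yx ->]; apply/setP=> z; apply/imsetP/idP=> [[u]|zy].
    by rewrite inE => uy ->.
  have zx : z \in component P Q x.
    by move: z zy; apply: porbit_ind => // z _; apply: component_P.
  by exists (Sub z zx : X); rewrite ?inE.
have pull_push : push val [seq pull V | V <- ms] = ms.
  rewrite /push -map_comp -[RHS]map_id; apply/eq_in_map=> V Vms /=.
  exact: pullK.
have valR (u : h) : val (Rperm h u) = P (val u) by apply: PX_val.
have val_porbit (u : h) : (val @: porbit (Rperm h) u)%SET = porbit P (val u).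
  exact: imset_porbit.
have Uh : uniq [seq pull V | V <- ms].
  by rewrite map_inj_in_uniq // => V W Vm Wm eVW; rewrite -(pullK V Vm) eVW pullK.
have hV : {subset [seq pull V | V <- ms] <= vertices h}.
  move=> _ /mapP[V Vm ->]; have [y yx eV] := ms_P Vm.
  apply/imsetP; exists (Sub y yx : X) => //.
  by apply: (imset_inj val_inj); rewrite pullK // val_porbit.
have hr : porbit (Rperm h) rX \notin [seq pull V | V <- ms].
  apply: contra ms_x => /mapP[V Vm eV].
  by rewrite -(_ : V = porbit P x) // -(pullK V Vm) -eV val_porbit.
exists (MarkedHypermap Uh hV hr), val; split.
  by split=> //; apply: val_inj.
by move=> y yx; exists (Sub y yx : X).
Qed.

End Restriction.

(** * Gluing two hypermaps at a new root *)

Section Block.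

Variables X1 X2 : finType.

Definition lift1 (u : X1) : option (X1 + X2) := Some (inl u).
Definition lift2 (v : X2) : option (X1 + X2) := Some (inr v).

Lemma lift1_inj : injective lift1. Proof. by move=> u v []. Qed.
Lemma lift2_inj : injective lift2. Proof. by move=> u v []. Qed.

Definition glue_map (Y : Type) (r : Y) (f : X1 -> Y) (g : X2 -> Y)
    (z : option (X1 + X2)) : Y :=
  match z with None => r | Some (inl u) => f u | Some (inr v) => g v end.

Variables (s : {perm X1}) (t : {perm X2}).

Lemma block_inj : injective (glue_map None (lift1 \o s) (lift2 \o t)).
Proof. by move=> [[u|v]|] [[u'|v']|] //= [] /perm_inj ->. Qed.

Definition block : {perm option (X1 + X2)} := perm block_inj.

Lemma block_root : block None = None. Proof. by rewrite permE. Qed.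
Lemma block1 u : block (lift1 u) = lift1 (s u). Proof. by rewrite permE. Qed.
Lemma block2 v : block (lift2 v) = lift2 (t v). Proof. by rewrite permE. Qed.

Lemma porbit_block1 u : porbit block (lift1 u) = (lift1 @: porbit s u)%SET.
Proof. by apply/esym/imset_porbit=> v; rewrite block1. Qed.

Lemma porbit_block2 v : porbit block (lift2 v) = (lift2 @: porbit t v)%SET.
Proof. by apply/esym/imset_porbit=> u; rewrite block2. Qed.

Lemma card_porbits_block :
  #|porbits block| = (#|porbits s| + #|porbits t|).+1.
Proof.
pose up1 (V : {set X1}) := (lift1 @: V)%SET.
pose up2 (V : {set X2}) := (lift2 @: V)%SET.
have -> : porbits block =
    [set None] |: ((up1 @: porbits s) :|: (up2 @: porbits t))%SET.
  apply/setP=> V; rewrite !inE; apply/imsetP/idP=> [[[[u|v]|] _ ->]|].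
  - by rewrite porbit_block1 (imset_f up1) ?orbT // imset_f.
  - by rewrite porbit_block2 (imset_f up2) ?orbT // imset_f.
  - by rewrite porbit_fixed ?block_root // eqxx.
  case/or3P=> [/eqP->|/imsetP[_ /imsetP[u _ ->] ->]|/imsetP[_ /imsetP[v _ ->] ->]].
  - by exists None; rewrite // porbit_fixed ?block_root.
  - by exists (lift1 u); rewrite // porbit_block1.
  - by exists (lift2 v); rewrite // porbit_block2.
have inj1 : injective up1 by move=> V W /(imset_inj (@lift1_inj)).
have inj2 : injective up2 by move=> V W /(imset_inj (@lift2_inj)).
rewrite cardsU1 cardsU (card_imset _ inj1) (card_imset _ inj2).
have -> : [set None] \notin (up1 @: porbits s :|: up2 @: porbits t)%SET.
  apply/negP; rewrite inE => /orP[]/imsetP[V _ /setP/(_ None)].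
    by rewrite inE eqxx => /esym/imsetP[].
  by rewrite inE eqxx => /esym/imsetP[].
have -> : (up1 @: porbits s :&: up2 @: porbits t)%SET = set0.
  apply/setP=> V; rewrite !inE; apply/negP=> /andP[].
  move=> /imsetP[_ /imsetP[u _ ->] ->] /imsetP[W _ /setP/(_ (lift1 u))].
  by rewrite imset_f ?porbit_id // => /esym/imsetP[].
by rewrite cards0 subn0 add1n.
Qed.

End Block.

Arguments lift1 {X1 X2} u.
Arguments lift2 {X1 X2} v.

Lemma blockM (X1 X2 : finType) (s s' : {perm X1}) (t t' : {perm X2}) :
  (block s t * block s' t')%g = block (s * s')%g (t * t')%g.
Proof.
apply/permP=> -[[u|v]|]; rewrite permM.
- by rewrite -/(lift1 u) !block1 permM.
- by rewrite -/(lift2 v) !block2 permM.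
by rewrite !block_root.
Qed.

Lemma blockV (X1 X2 : finType) (s : {perm X1}) (t : {perm X2}) :
  ((block s t)^-1)%g = block s^-1 t^-1.
Proof.
apply/eqP; rewrite eq_invg_mul blockM !mulgV; apply/eqP/permP.
case=> [[u|v]|]; rewrite perm1.
- by rewrite -/(lift1 u) block1 perm1.
- by rewrite -/(lift2 v) block2 perm1.
by rewrite block_root.
Qed.

(** S is finite, so s maps it onto itself. *)
Lemma perm_closedV (T : finType) (s : {perm T}) (S : {set T}) :
  (forall y, y \in S -> s y \in S) -> forall y, s y \in S -> y \in S.
Proof.
move=> Ss; have sS : (s @: S)%SET = S.
  apply/eqP; rewrite eqEcard card_imset ?leqnn ?andbT; last exact: perm_inj.
  by apply/subsetP=> _ /imsetP[y yS ->]; apply: Ss.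
by move=> y; rewrite -{1}sS mem_imset //; apply: perm_inj.
Qed.

(** The permutations A, B and R0 of a hypermap M: its hyperedge and face
    permutations bypass the root. *)
Section Cut.

Variable M : marked_hypermap.

Definition Fperm : {perm M} := (Lperm M * Rperm M)%g.
Definition hroot : M := Defs.root M.
Definition root_L : M := Lperm M hroot.
Definition root_F : M := Fperm hroot.
Definition cutL : {perm M} := (Lperm M * tperm hroot root_L)%g.
Definition cutF : {perm M} := (Fperm * tperm hroot root_F)%g.
Definition cutR : {perm M} := (cutL^-1 * cutF)%g.

Lemma cutL_root : cutL hroot = hroot. Proof. by rewrite permM tpermR. Qed.
Lemma cutF_root : cutF hroot = hroot. Proof. by rewrite permM tpermR. Qed.
Lemma Lperm_cut : Lperm M = (cutL * tperm hroot root_L)%g.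
Proof. by rewrite /cutL -mulgA tperm2 mulg1. Qed.
Lemma Fperm_cut : Fperm = (cutF * tperm hroot root_F)%g.
Proof. by rewrite /cutF -mulgA tperm2 mulg1. Qed.
Lemma Rperm_cut :
  Rperm M = ((cutL * tperm hroot root_L)^-1 * (cutF * tperm hroot root_F))%g.
Proof. by rewrite -Lperm_cut -Fperm_cut /Fperm mulKg. Qed.

End Cut.

(** The reverse construction: the darts of both pieces and a new root None. In the
    first piece hyperedges and faces are interchanged, whence the asymmetry between
    [sepL] and [sepF]. *)
Section Glue.

Variables s1 s2 : seq_hypermap.

Let T0 : finType := option (darts s1 + darts s2).

Definition sepL : {perm T0} := block (sF s1) (sL s2).
Definition sepF : {perm T0} := block (sL s1) (sF s2).
Definition root1 : T0 := omap inl (sroot s1).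
Definition root2 : T0 := omap inr (sroot s2).
Definition sepR : {perm T0} := (sepL^-1 * sepF)%g.
Definition glueL : {perm T0} := (sepL * tperm None root1)%g.

Lemma sepL_None : sepL None = None. Proof. exact: block_root. Qed.
Lemma sepF_None : sepF None = None. Proof. exact: block_root. Qed.

(** The first piece contributes its vertices with the reverse orientation, because
    of the interchange of its hyperedges and faces. *)
Lemma sepR_E : sepR = block (sR s1)^-1 (sR s2).
Proof. by rewrite /sepR blockV blockM /sF invMg mulgKV mulKg. Qed.

Lemma porbit_sepR_lift1 u : porbit sepR (lift1 u) = (lift1 @: porbit (sR s1) u)%SET.
Proof. by rewrite sepR_E porbit_block1 porbitV. Qed.

Lemma porbit_sepR_lift2 v : porbit sepR (lift2 v) = (lift2 @: porbit (sR s2) v)%SET.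
Proof. by rewrite sepR_E porbit_block2. Qed.

Variable b : T0.

Definition glueF : {perm T0} := (sepF * tperm None b)%g.
Definition glueR : {perm T0} := (glueL^-1 * glueF)%g.

Definition gluing (M : marked_hypermap) (io : T0 -> M) : Prop :=
  [/\ bijective io, forall z, io (glueR z) = Rperm M (io z),
      forall z, io (glueL z) = Lperm M (io z) & io None = hroot M].

Definition glued (M : marked_hypermap) (ms : seq {set T0}) : Prop :=
  exists2 io, @gluing M io & push io ms = marked M.

(** The glued hypermap is connected in two situations: the image b of the new root
    under the face permutation is the root of the second piece, or there is no
    second piece and b is arbitrary. *)
Definition attached : Prop := b = root2 \/ s2 = EmptyHypermap.

Lemma glueL_None : glueL None = root1.
Proof. by rewrite permM sepL_None tpermL. Qed.

Lemma glueF_None : glueF None = b.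
Proof. by rewrite permM sepF_None tpermL. Qed.

Lemma glueR_last : glueR root1 = b.
Proof. exact: frame_last sepL_None sepF_None. Qed.

Lemma sepL_E z : sepL z = tperm None root1 (glueL z).
Proof. by rewrite /glueL permM tpermK. Qed.

Lemma glueF_E z : glueF z = glueR (glueL z).
Proof. by rewrite /glueR [RHS]permM permK. Qed.

Lemma sepF_E z : sepF z = tperm None b (glueR (glueL z)).
Proof. by rewrite -glueF_E /glueF permM tpermK. Qed.

Lemma glued_transitive : attached ->
  [transitive <<[set glueR; glueL]>>%g, on [set: T0] | 'P].
Proof.
move=> att; apply: (@transitive_closed _ _ _ None) => S SN SR SL.
have Sa : root1 \in S by rewrite -glueL_None SL.
have Sb : b \in S by rewrite -glueR_last SR.
have SA z : z \in S -> sepL z \in S.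
  by move=> zS; rewrite sepL_E tperm_closed ?SL.
have SB z : z \in S -> sepF z \in S.
  by move=> zS; rewrite sepF_E tperm_closed ?SR ?SL.
have S1 u : lift1 u \in S.
  elim/seq_dart_ind: u => [u ru|u uS|u uS].
  - by move: Sa; rewrite /root1 ru.
  - have : lift1 ((sL s1)^-1 u)%g \in S.
      by apply: (perm_closedV SB); rewrite block1 permKV.
    by move/SA; rewrite block1 permM permKV.
  by rewrite -(block1 _ (sF s2)); apply: SB.
have S2 v : lift2 v \in S.
  case: att => [eb|]; last by move=> e2; exfalso; move: v; rewrite e2 => -[].
  elim/seq_dart_ind: v => [v rv|v vS|v vS].
  - by move: Sb; rewrite eb /root2 rv.
  - have : lift2 ((sL s2)^-1 v)%g \in S.
      by apply: (perm_closedV SA); rewrite block2 permKV.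
    by move/SB; rewrite block2 permM permKV.
  by rewrite -(block2 (sF s1)); apply: SA.
by case=> [[u|v]|] //; [apply: S1 | apply: S2].
Qed.

Lemma glued_exists ms : attached -> uniq ms ->
  {subset ms <= porbits glueR} -> porbit glueR None \notin ms ->
  exists M, glued M ms.
Proof.
move=> att Ums msR msN; pose h := Hypermap (glued_transitive att).
exists (@MarkedHypermap h None ms Ums msR msN), id; last by rewrite push_id.
by split=> //; exists id.
Qed.

Lemma glued_iso M M' ms : glued M ms -> marked_iso M M' -> glued M' ms.
Proof.
move=> [io [bio ioR ioL ior] iom] [phi [bphi phiR phiL phir phim]].
exists (phi \o io); first split.
- exact: bij_comp.
- by move=> z /=; rewrite ioR phiR.
- by move=> z /=; rewrite ioL phiL.
- by rewrite /= ior.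
by rewrite push_comp iom.
Qed.

Lemma glued_det M M' ms : glued M ms -> glued M' ms -> marked_iso M M'.
Proof.
move=> [io [[oi ioK oiK] ioR ioL ior] iom] [io' [bio' ioR' ioL' ior'] iom'].
exists (io' \o oi); split.
- by apply: bij_comp => //; exists io.
- by move=> z /=; rewrite -{1}(oiK z) -ioR ioK ioR'.
- by move=> z /=; rewrite -{1}(oiK z) -ioL ioK ioL'.
- by rewrite /= -/(hroot M) -ior ioK ior'.
by rewrite -iom -iom' -/(push _ _) -push_comp; apply: eq_push => z /=; rewrite ioK.
Qed.

(** A hypermap M glued along io has the same bypassed permutations as the model;
    in particular both pieces are placed in M. *)
Section Gluing.

Variables (M : marked_hypermap) (io : T0 -> M).
Hypothesis gl : gluing io.

Lemma gluing_inj : injective io.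
Proof. by case: gl => /bij_inj. Qed.

Lemma gluing_root1 : io root1 = root_L M.
Proof. by case: gl => _ _ ioL ior; rewrite -glueL_None ioL ior. Qed.

Lemma gluing_at : io b = root_F M.
Proof.
case: gl => _ ioR ioL ior.
by rewrite -glueF_None glueF_E ioR ioL ior /root_F /Fperm permM.
Qed.

Lemma gluing_sepL z : io (sepL z) = cutL M (io z).
Proof.
case: gl => _ _ ioL ior; rewrite sepL_E inj_tperm; last exact: gluing_inj.
by rewrite ioL ior gluing_root1 /cutL permM.
Qed.

Lemma gluing_sepF z : io (sepF z) = cutF M (io z).
Proof.
case: gl => _ ioR ioL ior; rewrite sepF_E inj_tperm; last exact: gluing_inj.
by rewrite ioR ioL ior gluing_at /cutF /Fperm !permM.
Qed.

Lemma gluing_sepR z : io (sepR z) = cutR M (io z).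
Proof.
have -> : sepR z = sepF ((sepL^-1)%g z) by rewrite [LHS]permM.
by rewrite [RHS]permM gluing_sepF -{2}(permKV sepL z) gluing_sepL permK.
Qed.

Lemma gluing_porbit_sepR z : (io @: porbit sepR z)%SET = porbit (cutR M) (io z).
Proof. exact: imset_porbit gluing_sepR z. Qed.

Lemma gluing_porbit z : (io @: porbit glueR z)%SET = porbit (Rperm M) (io z).
Proof. by case: gl => _ ioR _ _; apply: imset_porbit. Qed.

Lemma gluing_placed1 :
  placed (cutR M)^-1 (cutF M) (hroot M) (root_L M) (io \o @lift1 (darts s1) (darts s2)).
Proof.
have ior : io None = hroot M by case: gl.
split.
- by apply: inj_comp; [apply: gluing_inj | apply: lift1_inj].
- by move=> u /=; rewrite -ior (inj_eq gluing_inj).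
- move=> u /=; apply: (@perm_inj _ (cutR M)); rewrite permKV -gluing_sepR sepR_E.
  by rewrite block1 permK.
- by move=> u /=; rewrite -gluing_sepF block1.
by rewrite -gluing_root1 /root1 -ior; case: (sroot s1).
Qed.

Lemma gluing_placed2 : b = root2 ->
  placed (cutR M) (cutL M) (hroot M) (root_F M) (io \o @lift2 (darts s1) (darts s2)).
Proof.
move=> eb; have ior : io None = hroot M by case: gl.
split.
- by apply: inj_comp; [apply: gluing_inj | apply: lift2_inj].
- by move=> u /=; rewrite -ior (inj_eq gluing_inj).
- by move=> u /=; rewrite -gluing_sepR sepR_E block2.
- by move=> u /=; rewrite -gluing_sepL block2.
by rewrite -gluing_at eb /root2 -ior; case: (sroot s2).
Qed.

End Gluing.

End Glue.

(** Conversely, placements of the pieces which partition the darts other than the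
    root glue to M. *)
Lemma placed_gluing s1 s2 (M : marked_hypermap) (b : option (darts s1 + darts s2))
    (j1 : darts s1 -> M) (j2 : darts s2 -> M) x2 :
  placed (cutR M)^-1 (cutF M) (hroot M) (root_L M) j1 ->
  placed (cutR M) (cutL M) (hroot M) x2 j2 ->
  (forall u v, j1 u <> j2 v) ->
  (forall y, y != hroot M -> (exists u, j1 u = y) \/ (exists v, j2 v = y)) ->
  glue_map (hroot M) j1 j2 b = root_F M ->
  gluing b (glue_map (hroot M) j1 j2).
Proof.
move=> [i1 r1 R1 L1 a1] [i2 r2 R2 L2 _] dis cov jb.
set io := glue_map _ _ _ in jb *.
have ioi : injective io.
  move=> [[u|v]|] [[u'|v']|] //= =>
    [/i1->|/dis|/eqP|/esym/dis|/i2->|/eqP|/esym/eqP|/esym/eqP] //;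
  by rewrite ?(negPf (r1 _)) ?(negPf (r2 _)).
have ioa : io (root1 s1 s2) = root_L M by rewrite -a1 /root1; case: (sroot s1).
have ioA z : io (sepL s1 s2 z) = cutL M (io z).
  case: z => [[u|v]|]; last by rewrite sepL_None cutL_root.
    rewrite -/(lift1 u) block1 /= /sF permM R1 L1.
    by rewrite -[LHS]permM /cutR invMg invgK mulKVg.
  by rewrite -/(lift2 v) block2 /= L2.
have ioB z : io (sepF s1 s2 z) = cutF M (io z).
  case: z => [[u|v]|]; last by rewrite sepF_None cutF_root.
    by rewrite -/(lift1 u) block1 /= L1.
  rewrite -/(lift2 v) block2 /= /sF permM R2 L2.
  by rewrite -[LHS]permM /cutR mulKVg.
have ioL z : io (glueL s1 s2 z) = Lperm M (io z).
  by rewrite Lperm_cut [RHS]permM [glueL _ _ z]permM inj_tperm // ioA ioa.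
have ioF z : io (glueF b z) = Fperm M (io z).
  by rewrite Fperm_cut [RHS]permM [glueF b z]permM inj_tperm // ioB jb.
split=> //.
- apply: inj_card_bij => //.
  have sur y : exists z, y = io z.
    have [->|yr] := eqVneq y (hroot M); first by exists None.
    by have [[u <-]|[v <-]] := cov y yr; [exists (lift1 u) | exists (lift2 v)].
  have /fin_all_exists[g gK] := sur.
  by apply: (leq_card g) => y y' eg; rewrite (gK y) eg -gK.
move=> z; rewrite [glueR b z]permM ioF -{2}(permKV (glueL s1 s2) z) ioL.
by rewrite [LHS]permM.
Qed.

(** Isomorphic pieces give isomorphic glued hypermaps. *)
Section Transport.

Variables (s1 s2 s1' s2' : seq_hypermap).
Variables (phi1 : darts s1 -> darts s1') (phi2 : darts s2 -> darts s2').
Hypotheses (m1 : seq_morph phi1) (m2 : seq_morph phi2).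

Definition both : option (darts s1 + darts s2) -> option (darts s1' + darts s2') :=
  glue_map None (lift1 \o phi1) (lift2 \o phi2).

Lemma both_inj : injective both.
Proof.
have [/bij_inj i1 _ _ _] := m1; have [/bij_inj i2 _ _ _] := m2.
by move=> [[u|v]|] [[u'|v']|] //= [] => [/i1->|/i2->].
Qed.

Lemma both_root1 : both (root1 s1 s2) = root1 s1' s2'.
Proof. by rewrite /root1; have [_ _ _ <-] := m1; case: (sroot s1). Qed.

Lemma both_root2 : both (root2 s1 s2) = root2 s1' s2'.
Proof. by rewrite /root2; have [_ _ _ <-] := m2; case: (sroot s2). Qed.

Lemma both_sepL z : both (sepL s1 s2 z) = sepL s1' s2' (both z).
Proof.
have [_ R1 L1 _] := m1; have [_ R2 L2 _] := m2.
case: z => [[u|v]|]; rewrite ?sepL_None //.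
  by rewrite -/(lift1 u) block1 /= -/(lift1 _) block1 /sF /= !permM R1 L1.
by rewrite -/(lift2 v) block2 /= -/(lift2 _) block2 /= L2.
Qed.

Lemma both_sepF z : both (sepF s1 s2 z) = sepF s1' s2' (both z).
Proof.
have [_ R1 L1 _] := m1; have [_ R2 L2 _] := m2.
case: z => [[u|v]|]; rewrite ?sepF_None //.
  by rewrite -/(lift1 u) block1 /= -/(lift1 _) block1 /= L1.
by rewrite -/(lift2 v) block2 /= -/(lift2 _) block2 /sF /= !permM R2 L2.
Qed.

Lemma both_glueL z : both (glueL s1 s2 z) = glueL s1' s2' (both z).
Proof.
rewrite [glueL _ _ z]permM [RHS]permM inj_tperm; last exact: both_inj.
by rewrite both_sepL both_root1.
Qed.

Lemma both_glueR b z : both (glueR b z) = glueR (both b) (both z).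
Proof.
have FE y : both (glueF b y) = glueF (both b) (both y).
  rewrite [glueF b y]permM [RHS]permM inj_tperm; last exact: both_inj.
  by rewrite both_sepF.
by rewrite [glueR b z]permM FE -{2}(permKV (glueL s1 s2) z) both_glueL glueF_E.
Qed.

Lemma push_both_lift1 ms : push both (push lift1 ms) = push lift1 (push phi1 ms).
Proof. by rewrite -!push_comp; apply: eq_push. Qed.

Lemma push_both_lift2 ms : push both (push lift2 ms) = push lift2 (push phi2 ms).
Proof. by rewrite -!push_comp; apply: eq_push. Qed.

End Transport.

Lemma glued_transport s1 s2 s1' s2' phi1 phi2 b M ms :
  @seq_morph s1 s1' phi1 -> @seq_morph s2 s2' phi2 ->
  @glued s1 s2 b M ms -> glued (both phi1 phi2 b) M (push (both phi1 phi2) ms).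
Proof.
move=> m1 m2 [io [bio ioR ioL ior] iom].
have [[psi1 f1K g1K] _ _ _] := m1; have [[psi2 f2K g2K] _ _ _] := m2.
have m1' := seq_morph_inv m1 f1K g1K; have m2' := seq_morph_inv m2 f2K g2K.
have fK : cancel (both phi1 phi2) (both psi1 psi2).
  by case=> [[u|v]|] //=; rewrite ?f1K ?f2K.
have gK : cancel (both psi1 psi2) (both phi1 phi2).
  by case=> [[u|v]|] //=; rewrite ?g1K ?g2K.
exists (io \o both psi1 psi2); first split.
- by apply: bij_comp => //; exists (both phi1 phi2).
- by move=> z /=; rewrite (both_glueR m1' m2') fK ioR.
- by move=> z /=; rewrite (both_glueL m1' m2') ioL.
- by [].
by rewrite -push_comp -iom; apply: eq_push => z /=; rewrite fK.
Qed.

(** * Counting darts and cycles of a glued hypermap *)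

Definition is_empty (s : seq_hypermap) : bool := sroot s == None.

Lemma card_porbits_void (p : {perm void}) : #|porbits p| = 0.
Proof.
by apply: eq_card0 => V; apply/negP => /imsetP[[]].
Qed.

Lemma nfacesE s : nfaces s = #|porbits (sF s)| + is_empty s.
Proof.
by case: s => [|h] /=; rewrite ?card_porbits_void // /is_empty /= addn0.
Qed.

Lemma nverticesE s : nvertices s = #|porbits (sR s)| + is_empty s.
Proof.
by case: s => [|h] /=; rewrite ?card_porbits_void // /is_empty /= addn0.
Qed.

Lemma nhyperedgesE s : nhyperedges s = #|porbits (sL s)|.
Proof. by case: s => [|h] /=; rewrite ?card_porbits_void. Qed.

Lemma ndartsE s : ndarts s = #|darts s|.
Proof. by case: s => [|h] //=; rewrite card_void. Qed.

Lemma root_degreeE s :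
  root_degree s = oapp (fun u => #|porbit (sR s) u|) 0 (sroot s).
Proof. by case: s. Qed.

Lemma marked_degreesE s :
  marked_degrees s = [seq #|(V : {set darts s})| | V <- smarked s].
Proof. by case: s. Qed.

Lemma card_push (X Y : finType) (f : X -> Y) ms : injective f ->
  [seq #|(V : {set Y})| | V <- push f ms] = [seq #|(V : {set X})| | V <- ms].
Proof.
by move=> fi; rewrite -map_comp; apply: eq_map => V /=; rewrite card_imset.
Qed.

Lemma card_porbits_bij (X Y : finType) (s : {perm X}) (t : {perm Y}) (f : X -> Y) :
  bijective f -> (forall x, f (s x) = t (f x)) -> #|porbits s| = #|porbits t|.
Proof.
move=> bf fs; have fi := bij_inj bf.
have [g fK gK] := bf.
have inj_f : injective (fun V : {set X} => f @: V)%SET by apply: imset_inj.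
rewrite -(card_imset _ inj_f); apply: eq_card => V.
apply/imsetP/imsetP => [[_ /imsetP[x _ ->] ->]|[y _ ->]].
  by exists (f x); rewrite // (imset_porbit fs).
exists (porbit s (g y)); first exact: imset_f.
by rewrite (imset_porbit fs) gK.
Qed.

Lemma None_notin_lift1 (X1 X2 : finType) (V : {set X1}) :
  None \notin (@lift1 X1 X2 @: V)%SET.
Proof. by apply/negP=> /imsetP[]. Qed.

Lemma None_notin_lift2 (X1 X2 : finType) (V : {set X2}) :
  None \notin (@lift2 X1 X2 @: V)%SET.
Proof. by apply/negP=> /imsetP[]. Qed.

Lemma setD1_lift1 (X1 X2 : finType) (V : {set X1}) :
  (@lift1 X1 X2 @: V :\ None)%SET = (lift1 @: V)%SET.
Proof.
apply/setP=> z; rewrite in_setD1; case: eqVneq => [->|] //=.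
exact/esym/negbTE/None_notin_lift1.
Qed.

Lemma setD1_lift2 (X1 X2 : finType) (V : {set X2}) :
  (@lift2 X1 X2 @: V :\ None)%SET = (lift2 @: V)%SET.
Proof.
apply/setP=> z; rewrite in_setD1; case: eqVneq => [->|] //=.
exact/esym/negbTE/None_notin_lift2.
Qed.

Section GluedCounts.

Variables (s1 s2 : seq_hypermap) (b : option (darts s1 + darts s2)).
Variables (M : marked_hypermap) (io : option (darts s1 + darts s2) -> M).
Hypothesis gl : gluing b io.

Let a := root1 s1 s2.
Let a_None : (a == None) = is_empty s1.
Proof. by rewrite /a /root1 /is_empty; case: (sroot s1). Qed.

Lemma gluing_ndarts : #|M| = (ndarts s1 + ndarts s2).+1.
Proof.
case: gl => bio _ _ _; rewrite -(bij_eq_card bio) card_option card_sum.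
by rewrite !ndartsE.
Qed.

Lemma gluing_nhyperedges : #|hyperedges M| = nfaces s1 + nhyperedges s2.
Proof.
case: gl => bio _ ioL _; rewrite /hyperedges -(card_porbits_bij bio ioL).
have := card_porbits_insert a (sepL_None s1 s2).
rewrite -/(glueL s1 s2) card_porbits_block nfacesE nhyperedgesE a_None.
by case: is_empty => /=; lia.
Qed.

(** Stated with the F-cycles of s2 because the face that an empty s2 has by
    convention corresponds to a face of M only if b is the root. *)
Lemma gluing_nfaces :
  #|faces M| + (b != None) = (nhyperedges s1 + #|porbits (sF s2)|).+1.
Proof.
case: gl => bio ioR ioL _; rewrite /faces.
have ioF z : io (glueF b z) = (Lperm M * Rperm M)%g (io z).
  by rewrite glueF_E ioR ioL [RHS]permM.
rewrite -(card_porbits_bij bio ioF) (card_porbits_insert b (sepF_None s1 s2)).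
by rewrite card_porbits_block nhyperedgesE.
Qed.

(** The last term is nonzero when the root has cut a vertex of the pieces in two. *)
Lemma gluing_nvertices :
  #|vertices M| + ~~ is_empty s1 + (b != None) =
  (#|porbits (sR s1)| + #|porbits (sR s2)|).+1 + (None \notin porbit (glueR b) a).*2.
Proof.
case: gl => bio ioR _ _; rewrite /vertices -(card_porbits_bij bio ioR).
have := card_vertices_frame a b (sepL_None s1 s2) (sepF_None s1 s2).
rewrite /= a_None -/(sepR s1 s2) sepR_E card_porbits_block porbitsV => <-.
by [].
Qed.

Lemma gluing_root_degree : root_degree (NonemptyHypermap M) = #|porbit (glueR b) None|.
Proof.
have io_i := gluing_inj gl.
have [_ _ _ ior] := gl; rewrite /= -/(hroot M) -ior -(gluing_porbit gl).
by rewrite card_imset.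
Qed.

Lemma card_porbit_root1 : #|porbit (sepR s1 s2) a :\ None| = root_degree s1.
Proof.
rewrite /a /root1 root_degreeE; case: (sroot s1) => [u|] /=; last first.
  rewrite frame_porbit_root ?sepL_None ?sepF_None //.
  by apply: eq_card0 => z; rewrite !inE andbC; case: eqVneq.
rewrite -/(lift1 _) porbit_sepR_lift1 setD1_lift1.
by rewrite card_imset //; apply: lift1_inj.
Qed.

Lemma card_porbit_root2 :
  #|porbit (sepR s1 s2) (root2 s1 s2) :\ None| = root_degree s2.
Proof.
rewrite /root2 root_degreeE; case: (sroot s2) => [u|] /=; last first.
  rewrite frame_porbit_root ?sepL_None ?sepF_None //.
  by apply: eq_card0 => z; rewrite !inE andbC; case: eqVneq.
rewrite -/(lift2 _) porbit_sepR_lift2 setD1_lift2.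
by rewrite card_imset //; apply: lift2_inj.
Qed.

End GluedCounts.

(** * Lists, canonical darts and vertices of the glued hypermap *)

(** The inverse of [remove_nth]. *)
Definition insert (T : Type) (j : nat) (x : T) (l : seq T) : seq T :=
  take j l ++ x :: drop j l.

Lemma insertK (T : Type) j (x : T) l : j <= size l -> remove_nth j (insert j x l) = l.
Proof.
move=> jl; have sj : size (take j l) = j by rewrite size_takel.
rewrite /remove_nth /insert take_cat drop_cat sj ltnn ltnNge leqnSn /= subnn.
by rewrite subSnn /= drop0 cats0 cat_take_drop.
Qed.

Lemma nth_insert (T : Type) j (x x0 : T) l : j <= size l ->
  nth x0 (insert j x l) j = x.
Proof. by move=> jl; rewrite nth_cat size_takel // ltnn subnn. Qed.

Lemma size_insert (T : Type) j (x : T) l : size (insert j x l) = (size l).+1.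
Proof. by rewrite size_cat /= addnS -size_cat cat_take_drop. Qed.

Lemma map_insert (T U : Type) (f : T -> U) j x l :
  map f (insert j x l) = insert j (f x) (map f l).
Proof. by rewrite map_cat /= map_take map_drop. Qed.

Lemma push_insert (X Y : finType) (f : X -> Y) j V ms :
  push f (insert j V ms) = insert j (f @: V)%SET (push f ms).
Proof. exact: map_insert. Qed.

Lemma insert_remove (T : Type) (x0 : T) j l : j < size l ->
  insert j (nth x0 l j) (remove_nth j l) = l.
Proof.
move=> jl; have sj : size (take j l) = j by rewrite size_takel // ltnW.
rewrite /insert /remove_nth take_cat drop_cat sj ltnn subnn take0 drop0 cats0.
by rewrite -drop_nth // cat_take_drop.
Qed.

Lemma perm_insert (T : eqType) j (x : T) l : perm_eq (insert j x l) (x :: l).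
Proof. by rewrite /insert -[x :: drop j l]cat1s perm_catCA /= perm_cons cat_take_drop. Qed.

Lemma size_remove_nth (T : Type) j (l : seq T) : j < size l ->
  (size (remove_nth j l)).+1 = size l.
Proof.
by move=> jl; rewrite size_cat size_takel ?size_drop ?(ltnW jl) //; lia.
Qed.

Section Masks.

Variable T : Type.

Lemma mask_merge (m : bitseq) (l1 l2 : seq T) :
  count id m = size l1 -> count negb m = size l2 ->
  exists l, [/\ size m = size l, mask m l = l1 & co_mask m l = l2].
Proof.
elim: m l1 l2 => [|[] m IHm] l1 l2.
- by case: l1 l2 => [|? ?] [|? ?] // _ _; exists [::].
- case: l1 => [|x l1] //= [c1]; rewrite add0n => c2.
  by have [l [sl <- <-]] := IHm _ _ c1 c2; exists (x :: l); rewrite /= sl.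
case: l2 => [|x l2] //=; rewrite add0n => c1 [c2].
by have [l [sl <- <-]] := IHm _ _ c1 c2; exists (x :: l); rewrite /= sl.
Qed.

Lemma mask_comask_inj (m : bitseq) (l l' : seq T) :
  size m = size l -> size m = size l' ->
  mask m l = mask m l' -> co_mask m l = co_mask m l' -> l = l'.
Proof.
rewrite /co_mask; elim: m l l' => [|d m IHm] [|x l] [|x' l'] //= [sl] [sl'].
by case: d => /=; [move=> [-> e1] e2 | move=> e1 [-> e2]]; rewrite (IHm l l').
Qed.

Lemma mask_determined (p : pred T) (m : bitseq) (l : seq T) :
  size m = size l -> all p (mask m l) -> all (predC p) (co_mask m l) ->
  m = map p l.
Proof.
rewrite /co_mask; elim: m l => [|d m IHm] [|x l] //= [sl].
by case: d => /= [/andP[-> a1] a2|a1 /andP[/negbTE-> a2]]; rewrite -IHm.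
Qed.

Lemma comask_map (p : pred T) (l : seq T) :
  co_mask (map p l) l = filter (predC p) l.
Proof. by rewrite /co_mask -map_comp filter_mask. Qed.

Lemma map_comask (U : Type) (f : T -> U) m l :
  map f (co_mask m l) = co_mask m (map f l).
Proof. by rewrite /co_mask map_mask. Qed.

End Masks.

Lemma perm_mask_comask (T : eqType) (m : bitseq) (l : seq T) :
  size m = size l -> perm_eq l (mask m l ++ co_mask m l).
Proof.
rewrite /co_mask; elim: m l => [|d m IHm] [|x l] //= [sl].
case: d => /=; first by rewrite perm_cons IHm.
by rewrite perm_sym perm_catC /= perm_cons perm_catC perm_sym IHm.
Qed.

(** A canonical dart in each vertex of a rooted hypermap, invariant under
    isomorphism: the end of the first word in the two permutations, in an arbitrary
    fixed enumeration of words, which leads from the root into the vertex. It serves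
    as the origin when the darts of a vertex of degree p are numbered from 1 to p. *)
Section Entry.

Variable h : marked_hypermap.

Definition walk (w : seq bool) : h :=
  foldl (fun x d => if d : bool then Rperm h x else Lperm h x) (Defs.root h) w.

Definition is_entry (V : {set h}) (x : h) : Prop :=
  exists w, [/\ walk w = x, x \in V &
                forall w', walk w' \in V -> pickle w <= pickle w'].

Lemma walk_onto x : exists w, walk w = x.
Proof.
apply: (dart_ind (x := Defs.root h) (Pr := fun x => exists w, walk w = x)).
- by exists [::].
- by move=> y [w <-]; exists (rcons w true); rewrite /walk foldl_rcons.
by move=> y [w <-]; exists (rcons w false); rewrite /walk foldl_rcons.
Qed.

Lemma is_entry_exists (V : {set h}) x : x \in V -> exists y, is_entry V y.
Proof.
(* [pickle_inv] rather than [unpickle], so that the code of a word is unique. *)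
move=> xV; pose p n := if @pickle_inv (seq bool) n is Some w then walk w \in V else false.
have exp : exists n, p n.
  by have [w wx] := walk_onto x; exists (pickle w); rewrite /p pickleK_inv wx.
have [n pn minn] := ex_minnP exp; move: pn; rewrite /p.
have := @pickle_invK (seq bool) n; case: pickle_inv => //= w wn wV.
exists (walk w), w; split=> // w' w'V.
by rewrite wn; apply: minn; rewrite /p pickleK_inv.
Qed.

Lemma is_entry_uniq V x y : is_entry V x -> is_entry V y -> x = y.
Proof.
move=> [w [<- wV minw]] [w' [<- w'V minw']]; congr walk.
apply: (pcan_inj pickleK); apply/eqP; rewrite eqn_leq.
by rewrite minw ?minw'.
Qed.

End Entry.

Lemma is_entry_iso (h h' : marked_hypermap) phi V x :
  @seq_morph (NonemptyHypermap h) (NonemptyHypermap h') phi ->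
  is_entry V x -> @is_entry h' (phi @: V)%SET (phi x).
Proof.
move=> [bphi phiR phiL [phir]] [w [wx xV minw]].
have walkE w' : walk h' w' = phi (walk h w').
  elim/last_ind: w' => [|w' d IHw]; first by rewrite /walk /= phir.
  rewrite /walk !foldl_rcons -!/(walk _ _) IHw.
  by case: d; rewrite ?[LHS](esym (phiR _)) ?[LHS](esym (phiL _)).
exists w; split; rewrite ?walkE ?wx ?imset_f // => w'.
by rewrite walkE mem_imset; [apply: minw | apply: bij_inj].
Qed.

Lemma smarked_vertex s V : V \in smarked s ->
  exists2 u, V = porbit (sR s) u &
             forall x, sroot s = Some x -> u \notin porbit (sR s) x.
Proof.
case: s V => //= h V Vm; have /imsetP[u _ eV] := marked_vertices Vm.
exists u => // x [<-]; rewrite -eq_porbit_mem -eV.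
by apply: contra (root_unmarked h) => /eqP <-.
Qed.

Lemma smarked_uniq s : uniq (smarked s).
Proof. by case: s => // h; apply: marked_uniq. Qed.

Section Model.

Variables (s1 s2 : seq_hypermap) (b : option (darts s1 + darts s2)).

Let T0 : finType := option (darts s1 + darts s2).
Let a : T0 := root1 s1 s2.
Let R0 : {perm T0} := sepR s1 s2.
Let gAr := sepL_None s1 s2.
Let gBr := sepF_None s1 s2.

Lemma porbit_sepR_None : porbit R0 None = [set None].
Proof. exact: frame_porbit_root gAr gBr. Qed.

Lemma mem_porbit_root1 z : z \in porbit R0 a -> z != None ->
  exists2 x, sroot s1 = Some x & exists2 u, u \in porbit (sR s1) x & z = lift1 u.
Proof.
rewrite /a /root1; case: (sroot s1) => [x|] /=; last first.
  by rewrite porbit_sepR_None inE => ->.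
by rewrite -/(lift1 x) porbit_sepR_lift1 => /imsetP[u ux ->] _; exists x => //; exists u.
Qed.

Lemma lift1_marked V : V \in push lift1 (smarked s1) ->
  exists u, [/\ V = porbit R0 (lift1 u), lift1 u \notin porbit R0 a,
    porbit (sR s1) u \in smarked s1 & V = (lift1 @: porbit (sR s1) u)%SET].
Proof.
move=> /mapP[W Wm ->]; have [u eW ur] := smarked_vertex Wm.
exists u; rewrite -?eW porbit_sepR_lift1 -?eW; split=> //.
apply/negP=> /mem_porbit_root1[] // x rx [v vx [euv]].
by have := ur x rx; rewrite euv vx.
Qed.

Lemma untouched_vertex z : z != None -> z \notin porbit R0 a ->
  z \notin porbit R0 b -> porbit R0 z \in porbits (glueR b).
Proof.
move=> zN za zb; rewrite -(porbit_untouched gAr gBr (a := a) (b := b)).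
  exact: imset_f.
by rewrite !inE !negb_or zN za.
Qed.

Section Joined.

Hypothesis J : a != None -> b \notin porbit R0 a.

Let touched0 := touched None a b (sepL s1 s2) (sepF s1 s2).

Lemma joined_root : porbit (glueR b) None = touched0.
Proof. exact: porbit_root_joined gAr gBr J. Qed.

Lemma joined_degree :
  #|porbit (glueR b) None| = (root_degree s1 + #|porbit R0 b :\ None|).+1.
Proof.
rewrite joined_root (card_touched_joined gAr gBr J).
by rewrite -(card_porbit_root1 s1 s2).
Qed.

Lemma joined_root1 : None \in porbit (glueR b) a.
Proof.
by rewrite porbit_sym joined_root !inE porbit_id orbT.
Qed.

End Joined.

End Model.

(** * The four ways of adding a root *)

(** One piece h, with b reached from its root by k steps along its root vertex. In
    the glued hypermap the vertex permutation of h is reversed, so that these steps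
    become the segment of k + 1 darts which is cut off. *)
Section CutModel.

Variables (h : marked_hypermap) (k : nat).

Let x := Defs.root h.
Let b : option (darts (NE h) + darts EE) := @lift1 (darts (NE h)) _ (iter k (Rperm h) x).
Let a := root1 (NE h) EE.
Let R0 := sepR (NE h) EE.
Let gAr := sepL_None (NE h) EE.
Let gBr := sepF_None (NE h) EE.

Hypothesis kx : k < #|porbit (Rperm h) x|.

Let iter_b : iter k R0 b = a.
Proof.
rewrite /b /a /root1 /= -/(lift1 x); elim: k x => // i IHi y.
rewrite iterSr (_ : R0 _ = lift1 (iter i (Rperm h) y)) //.
by rewrite /R0 sepR_E iterS -/(lift1 _) block1 permK.
Qed.

Let km : k < #|porbit R0 b|.
Proof.
rewrite /R0 /b porbit_sepR_lift1 card_imset; last exact: lift1_inj.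
by rewrite -permX porbit_perm.
Qed.

Let a_neq : a != None. Proof. by []. Qed.

Lemma cut_root_degree : #|porbit (glueR b) None| + k = root_degree (NE h).
Proof.
rewrite (card_porbit_root_cut gAr gBr a_neq km iter_b) porbit_sepR_lift1.
rewrite card_imset; last exact: lift1_inj.
by rewrite subnK // ltnW.
Qed.

Lemma cut_last_degree : #|porbit (glueR b) a| = k.+1.
Proof. by rewrite (card_porbit_last_cut gAr gBr a_neq km iter_b). Qed.

Lemma cut_last_root : None \notin porbit (glueR b) a.
Proof. exact: (root_notin_last_cut gAr gBr a_neq km iter_b). Qed.

Lemma cut_b : b \in porbit R0 a.
Proof. by rewrite porbit_sym -iter_b -permX mem_porbit. Qed.

End CutModel.

(** After the removal of the root of M, its images a and b lie in different
    components, or one of them was the root itself. *)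
Definition splits (M : marked_hypermap) (m : bitseq) (s1 s2 : seq_hypermap) :=
  exists ms, [/\ glued (root2 s1 s2) M ms, size m = size ms,
    mask m ms = push lift1 (smarked s1) & co_mask m ms = push lift2 (smarked s2)].

Definition single (h : marked_hypermap) (u : h) :
    option (darts (NE h) + darts EE) := @lift1 (darts (NE h)) (darts EE) u.

(** Removing the root of M splits the root vertex, without disconnecting M. The new
    root is in one part, and the other part becomes the first distinguished vertex;
    i tells where the face permutation of M enters it. *)
Definition splits_vertex (M h : marked_hypermap) (i : nat) :=
  exists V vs y, [/\ marked h = V :: vs, is_entry V y, i < #|V|
    & glued (single (iter i (Rperm h) y)) M (push (@single h) vs)].

Definition root_step (h : marked_hypermap) (k : nat) : option (darts (NE h) + darts EE) :=
  single (iter k (Rperm h) (Defs.root h)).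

(** Removing the root of M merges the root vertex with another vertex, here one
    that is not distinguished. *)
Definition merges_unmarked (M h : marked_hypermap) (k : nat) :=
  k < #|porbit (Rperm h) (Defs.root h)| /\
  glued (root_step h k) M (push (@single h) (marked h)).

(** The vertex merged with the root vertex is the j-th distinguished one. *)
Definition merges_marked (M h : marked_hypermap) (j k : nat) :=
  [/\ k < #|porbit (Rperm h) (Defs.root h)|, j <= size (marked h)
    & glued (root_step h k) M
        (insert j (porbit (glueR (root_step h k)) (root1 (NE h) EE))
           (push (@single h) (marked h)))].

Definition marked_degs (h : marked_hypermap) := marked_degrees (NE h).

Lemma glued_degs s1 s2 b M ms : @glued s1 s2 b M ms ->
  marked_degs M = [seq #|(V : {set option (darts s1 + darts s2)})| | V <- ms].
Proof.
move=> [io gl iom]; rewrite -(card_push _ (gluing_inj gl)).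
by rewrite /marked_degs /= -iom.
Qed.

(** Two pieces share no vertex, so the root joins their root vertices. *)
Lemma root2_notin_porbit_root1 s1 s2 : root1 s1 s2 != None ->
  root2 s1 s2 \notin porbit (sepR s1 s2) (root1 s1 s2).
Proof.
rewrite /root1; case: (sroot s1) => [x _|] //=; rewrite -/(lift1 x) porbit_sepR_lift1.
by rewrite /root2; case: (sroot s2) => [y|] /=; apply/negP=> /imsetP[].
Qed.

Lemma splits_counts M m s1 s2 : splits M m s1 s2 ->
  [/\ ndarts (NE M) = (ndarts s1 + ndarts s2).+1,
      nhyperedges (NE M) = nfaces s1 + nhyperedges s2,
      nfaces (NE M) = nhyperedges s1 + nfaces s2,
      (nvertices (NE M)).+1 = nvertices s1 + nvertices s2
    & root_degree (NE M) = (root_degree s1 + root_degree s2).+1] /\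
  [/\ size m = size (marked_degs M), mask m (marked_degs M) = marked_degrees s1
    & co_mask m (marked_degs M) = marked_degrees s2].
Proof.
move=> [ms [gm sm m1 m2]]; have [io gl iom] := gm.
have gbN : (root2 s1 s2 == None) = is_empty s2.
  by rewrite /root2 /is_empty; case: (sroot s2).
split; [split|split].
- exact: gluing_ndarts gl.
- exact: gluing_nhyperedges gl.
- have := gluing_nfaces gl; rewrite gbN [nfaces s2]nfacesE /=.
  by case: (is_empty s2) => /=; lia.
- have := gluing_nvertices gl.
  rewrite gbN (joined_root1 (@root2_notin_porbit_root1 s1 s2)) /= !nverticesE.
  by case: (is_empty s1); case: (is_empty s2) => /=; lia.
- rewrite (gluing_root_degree gl) (joined_degree (@root2_notin_porbit_root1 s1 s2)).
  by rewrite card_porbit_root2.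
- by rewrite (glued_degs gm) size_map.
- rewrite (glued_degs gm) -map_mask m1 marked_degreesE card_push //.
  exact: lift1_inj.
rewrite (glued_degs gm) -map_comask m2 marked_degreesE card_push //.
exact: lift2_inj.
Qed.

Lemma single_inj h : injective (@single h).
Proof. exact: lift1_inj. Qed.

Lemma single_counts (M h : marked_hypermap) (u : h) ms : glued (single u) M ms ->
  [/\ ndarts (NE M) = (ndarts (NE h)).+1, nhyperedges (NE M) = nfaces (NE h)
    & nfaces (NE M) = nhyperedges (NE h)].
Proof.
move=> [io gl _]; split.
- by rewrite /= (gluing_ndarts gl) addn0.
- by rewrite /= (gluing_nhyperedges gl) addn0.
by have := gluing_nfaces gl; rewrite card_porbits_void /= addn0 addn1 => -[].
Qed.

(** A distinguished vertex of h is not its root vertex, so the root joins the two. *)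
Lemma entry_disjoint (h : marked_hypermap) V vs (y : h) i : marked h = V :: vs -> y \in V ->
  root1 (NE h) EE != None ->
  single (iter i (Rperm h) y) \notin porbit (sepR (NE h) EE) (root1 (NE h) EE).
Proof.
move=> em yV _; apply/negP=> /mem_porbit_root1[] // x [<-] [u ux [eu]].
have /(@smarked_vertex (NE h))[v eV /(_ _ erefl) /negP[]] :
  V \in smarked (NE h) by rewrite /= em mem_head.
rewrite -eu eV /= in ux yV.
rewrite -permX -eq_porbit_mem porbit_perm in ux; rewrite -eq_porbit_mem in yV.
by rewrite -eq_porbit_mem -(eqP yV).
Qed.

Lemma splits_vertex_counts M h i : splits_vertex M h i ->
  [/\ ndarts (NE M) = (ndarts (NE h)).+1, nhyperedges (NE M) = nfaces (NE h),
      nfaces (NE M) = nhyperedges (NE h),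
      (nvertices (NE M)).+1 = nvertices (NE h)
    & exists p, [/\ marked_degs h = p :: marked_degs M, i < p
       & root_degree (NE M) = (root_degree (NE h) + p).+1]].
Proof.
move=> [V [vs [y [em yent iV gm]]]]; have [n1 n2 n3] := single_counts gm.
have [io gl iom] := gm; have [w [_ yV _]] := yent.
have J := entry_disjoint i em yV; split=> //.
  have := gluing_nvertices gl; rewrite (joined_root1 J) card_porbits_void /=.
  by rewrite !addn1 !addn0 => -[].
exists #|V|; split=> //.
  rewrite (glued_degs gm) card_push; last exact: single_inj.
  by rewrite /marked_degs /= em.
rewrite (gluing_root_degree gl) (joined_degree J).
rewrite -/(single _) porbit_sepR_lift1 setD1_lift1 card_imset; last exact: lift1_inj.
have /(@smarked_vertex (NE h))[v eV _] :
  V \in smarked (NE h) by rewrite /= em mem_head.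
rewrite /= -permX porbit_perm; congr (_ + _).+1.
by move: yV; rewrite eV -eq_porbit_mem => /eqP ->.
Qed.

Lemma root_step_counts (M h : marked_hypermap) k ms :
  k < #|porbit (Rperm h) (Defs.root h)| ->
  glued (root_step h k) M ms ->
  [/\ ndarts (NE M) = (ndarts (NE h)).+1, nhyperedges (NE M) = nfaces (NE h),
      nfaces (NE M) = nhyperedges (NE h),
      nvertices (NE M) = (nvertices (NE h)).+1
    & root_degree (NE M) + k = root_degree (NE h)].
Proof.
move=> kh gm; have [n1 n2 n3] := single_counts gm; have [io gl iom] := gm.
split=> //; last by rewrite (gluing_root_degree gl) cut_root_degree.
have := gluing_nvertices gl; rewrite cut_last_root // card_porbits_void /=.
by rewrite !addn1 addn0 addn2 => -[].
Qed.

Lemma merges_unmarked_counts M h k : merges_unmarked M h k ->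
  [/\ ndarts (NE M) = (ndarts (NE h)).+1, nhyperedges (NE M) = nfaces (NE h),
      nfaces (NE M) = nhyperedges (NE h),
      nvertices (NE M) = (nvertices (NE h)).+1
    & root_degree (NE M) + k = root_degree (NE h)] /\ marked_degs h = marked_degs M.
Proof.
move=> [kh gm]; split; first exact: root_step_counts kh gm.
by rewrite (glued_degs gm) card_push //; apply: single_inj.
Qed.

Lemma merges_marked_counts M h j k : merges_marked M h j k ->
  [/\ ndarts (NE M) = (ndarts (NE h)).+1, nhyperedges (NE M) = nfaces (NE h),
      nfaces (NE M) = nhyperedges (NE h),
      nvertices (NE M) = (nvertices (NE h)).+1
    & root_degree (NE M) + k = root_degree (NE h)] /\
  [/\ j < size (marked_degs M), marked_degs h = remove_nth j (marked_degs M)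
    & nth 0 (marked_degs M) j = k.+1].
Proof.
move=> [kh jh gm]; split; first exact: root_step_counts kh gm.
rewrite (glued_degs gm) map_insert card_push; last exact: single_inj.
rewrite size_insert insertK ?nth_insert ?size_map // ltnS; split=> //.
exact: cut_last_degree.
Qed.

Lemma porbit_None_notin (T : finType) (s : {perm T}) (z : T) (ms : seq {set T}) :
  (forall V, V \in ms -> z \notin V) -> porbit s z \notin ms.
Proof. by move=> zms; apply/negP=> /zms; rewrite porbit_id. Qed.

(** The distinguished vertices of the pieces are interleaved as the mask tells.
    They are not touched by the new root, hence remain vertices. *)
Lemma splits_exists m s1 s2 :
  count id m = size (smarked s1) -> count negb m = size (smarked s2) ->
  exists M, splits M m s1 s2.
Proof.
move=> c1 c2.
pose p1 := push (@lift1 (darts s1) (darts s2)) (smarked s1).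
pose p2 := push (@lift2 (darts s1) (darts s2)) (smarked s2).
have [|| ms [sm m1 m2]] := @mask_merge _ m p1 p2; rewrite ?size_map //.
have pms : perm_eq ms (p1 ++ p2) by rewrite -m1 -m2; apply: perm_mask_comask.
suff [M gm] : exists M, glued (root2 s1 s2) M ms by exists M, ms.
have NoNone V : V \in ms -> None \notin V.
  rewrite (perm_mem pms) mem_cat => /orP[]/mapP[W _ ->].
    exact: None_notin_lift1.
  exact: None_notin_lift2.
apply: glued_exists; first by left.
- rewrite (perm_uniq pms) cat_uniq.
  rewrite !map_inj_uniq ?smarked_uniq /= ?andbT; first last.
  - by move=> V W /(imset_inj (@lift1_inj _ _)).
  - by move=> V W /(imset_inj (@lift2_inj _ _)).
  apply/hasPn=> _ /mapP[V Vm ->]; apply/mapP=> -[W Wm].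
  have [u -> _] := smarked_vertex Vm => /setP/(_ (lift2 u)).
  by rewrite imset_f ?porbit_id // => /esym/imsetP[].
- move=> V; rewrite (perm_mem pms) mem_cat => /orP[].
    move=> /lift1_marked[u [-> ua _ _]]; apply: untouched_vertex => //.
    rewrite /root2; case: (sroot s2) => [y|] /=; last by rewrite porbit_sepR_None inE.
    by rewrite -/(lift2 y) porbit_sepR_lift2; apply/negP=> /imsetP[].
  move=> /mapP[W Wm ->]; have [u -> ur] := smarked_vertex Wm.
  rewrite -porbit_sepR_lift2; apply: untouched_vertex => //.
    by apply/negP=> /mem_porbit_root1[] // x _ [].
  rewrite /root2; case: (sroot s2) ur => [y|] /= ur; last by rewrite porbit_sepR_None inE.
  rewrite -/(lift2 y) porbit_sepR_lift2 mem_imset; last exact: lift2_inj.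
  exact: ur.
exact: porbit_None_notin.
Qed.

Lemma single_exists (h : marked_hypermap) (u : h) ms : uniq ms ->
  (forall V, V \in ms -> V \in porbits (glueR (single u)) /\ None \notin V) ->
  exists M, glued (single u) M ms.
Proof.
move=> Ums msP; apply: glued_exists => //; first by right.
  by move=> V /msP[].
by apply: porbit_None_notin => V /msP[].
Qed.

Lemma single_marked (h : marked_hypermap) V : V \in push (@single h) (marked h) ->
  exists u : h, [/\ V = porbit (sepR (NE h) EE) (single u),
    single u \notin porbit (sepR (NE h) EE) (root1 (NE h) EE),
    porbit (Rperm h) u \in marked h & V = (@single h @: porbit (Rperm h) u)%SET].
Proof. exact: (@lift1_marked (NE h) EE). Qed.

Lemma splits_vertex_exists (h : marked_hypermap) (V : {set h}) (vs : seq {set h}) i :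
  marked h = V :: vs -> i < #|V| -> exists M, splits_vertex M h i.
Proof.
move=> em iV; have /andP[Vvs Uvs] : uniq (V :: vs) by rewrite -em marked_uniq.
have [v eV _] : exists2 v, V = porbit (Rperm h) v & true.
  have /(@smarked_vertex (NE h))[v -> _] : V \in smarked (NE h).
    by rewrite /= em mem_head.
  by exists v.
have [y yent] : exists y, is_entry V y.
  by apply: (@is_entry_exists h V v); rewrite eV porbit_id.
have [_ [_ yV _]] := yent.
suff [M gm] : exists M, glued (single (iter i (Rperm h) y)) M (push (@single h) vs).
  by exists M, V, vs, y.
apply: single_exists.
  by rewrite map_inj_uniq // => W W' /(imset_inj (@single_inj h)).
move=> _ /mapP[W Wvs ->]; split; last exact: None_notin_lift1.
have /single_marked[u [eW0 ua _ /(imset_inj (@single_inj h)) eW]] :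
    (@single h @: W)%SET \in push (@single h) (marked h).
  by rewrite em map_f // inE Wvs orbT.
rewrite eW0; apply: untouched_vertex => //.
rewrite -/(single _) porbit_sepR_lift1 mem_imset.
  rewrite /= -permX porbit_perm; apply: contra Vvs => uy.
  suff -> : V = W by [].
  rewrite eW; move: uy yV; rewrite eV -!eq_porbit_mem => /eqP-> /eqP->.
  by [].
exact: lift1_inj.
Qed.

Lemma root_step_marked (h : marked_hypermap) k V :
  k < #|porbit (Rperm h) (Defs.root h)| ->
  V \in push (@single h) (marked h) ->
  V \in porbits (glueR (root_step h k)) /\ None \notin V.
Proof.
move=> kh /single_marked[u [eV ua _ eV']]; split; last first.
  by rewrite eV' None_notin_lift1.
rewrite eV; apply: untouched_vertex => //.
have := cut_b h k; rewrite -eq_porbit_mem => /eqP eb.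
by rewrite /root_step /single eb.
Qed.

Lemma push_single_uniq (h : marked_hypermap) : uniq (push (@single h) (marked h)).
Proof.
by rewrite map_inj_uniq ?marked_uniq // => W W' /(imset_inj (@single_inj h)).
Qed.

Lemma merges_unmarked_exists (h : marked_hypermap) k :
  k < #|porbit (Rperm h) (Defs.root h)| ->
  exists M, merges_unmarked M h k.
Proof.
move=> kh; suff [M gm] : exists M, glued (root_step h k) M (push (@single h) (marked h)).
  by exists M.
by apply: single_exists => [|V]; [apply: push_single_uniq | apply: root_step_marked].
Qed.

Lemma merges_marked_exists (h : marked_hypermap) j k :
  k < #|porbit (Rperm h) (Defs.root h)| ->
  j <= size (marked h) -> exists M, merges_marked M h j k.
Proof.
move=> kh jh; pose W := porbit (glueR (root_step h k)) (root1 (NE h) EE).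
suff [M gm] : exists M, glued (root_step h k) M (insert j W (push (@single h) (marked h))).
  by exists M.
apply: single_exists => [|V].
  rewrite (perm_uniq (perm_insert _ _ _)) /= push_single_uniq andbT.
  apply/negP=> /single_marked[u [eW ua _ _]]; move: ua.
  by rewrite porbit_sym -eW porbit_id.
rewrite (perm_mem (perm_insert _ _ _)) inE => /predU1P[->|]; last exact: root_step_marked.
by split; [apply: imset_f | apply: cut_last_root].
Qed.

(** * Every hypermap arises by adding a root *)

Lemma component_eq (T : finType) (P Q P' Q' : {perm T}) :
  P \in <<[set P'; Q']>>%g -> Q \in <<[set P'; Q']>>%g ->
  P' \in <<[set P; Q]>>%g -> Q' \in <<[set P; Q]>>%g ->
  component P Q =1 component P' Q'.
Proof.
move=> Pi Qi P'i Q'i x; rewrite /component; congr orbit; apply/eqP.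
by rewrite eqEsubset !gen_subG !subUset !sub1set Pi Qi P'i Q'i.
Qed.

Lemma component_fixed (T : finType) (P Q : {perm T}) r x :
  P r = r -> Q r = r -> r \in component P Q x -> x = r.
Proof.
rewrite /component orbit_sym => Pr Qr; move: x.
by apply: component_ind => // y _ ->.
Qed.

(** The component of x without r, as a piece; it is empty if x = r. *)
Lemma seq_component_placed (T : finType) (P Q : {perm T}) r x ms :
  P r = r -> Q r = r -> uniq ms -> porbit P x \notin ms ->
  (forall V, V \in ms -> exists2 y, y \in component P Q x & V = porbit P y) ->
  exists s (j : darts s -> T), [/\ placed P Q r x j, push j (smarked s) = ms &
    forall y, y != r -> y \in component P Q x -> exists u, j u = y].
Proof.
move=> Pr Qr Ums msx msP; have [xr|xr] := eqVneq x r.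
  exists EE, (fun u : void => match u with end); split.
    by split=> //=; case.
    case: ms {Ums} msx msP => // V ms msx /(_ V (mem_head _ _))[y yx eV].
    move: yx; rewrite xr /component orbit_sym => /(component_fixed Pr Qr) yr.
    by rewrite xr -yr -eV mem_head in msx.
  move=> y yr; rewrite xr /component orbit_sym => /(component_fixed Pr Qr) ey.
  by rewrite ey eqxx in yr.
have [h [j [[ji jR jL jr jm] jsur]]] := component_placed Ums msx msP.
exists (NE h), j; split=> [|//|y _ yx]; last exact: jsur.
split=> //= u; apply: contraNneq xr => jur.
apply/eqP/(component_fixed Pr Qr); rewrite -jur.
apply: (dart_ind (x := Defs.root h) (Pr := fun v => j v \in component P Q x)).
- by rewrite jr component_id.
- by move=> v vx; rewrite jR component_P.
by move=> v vx; rewrite jL component_Q.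
Qed.

Section Decompose.

Variable M : marked_hypermap.

Let r := hroot M.
Let a := root_L M.
Let b := root_F M.
Let R0 := cutR M.
Let A := cutL M.
Let B := cutF M.
Let Ar : A r = r := cutL_root M.
Let Br : B r = r := cutF_root M.
Let R0r : R0 r = r. Proof. by rewrite [LHS]permM -{1}Ar permK. Qed.
Let R0Vr : (R0^-1)%g r = r. Proof. by rewrite -{1}R0r permK. Qed.

Let Ca := component R0^-1 B a.
Let Cb := component R0 A b.

(** Removing the root leaves a connected hypermap, and neither a nor b is the root:
    if b were the root, it could not be in the component of a. *)
Definition connected : bool :=
  (root_L M != hroot M) && (root_F M \in component (cutR M)^-1 (cutF M) (root_L M)).

(** Both readings of the bypassed permutations generate the same group. *)
Let compE : component R0^-1 B =1 component R0 A.
Proof.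
have gP (p q : {perm M}) : p \in <<[set p; q]>>%g by rewrite mem_gen ?set21.
have gQ (p q : {perm M}) : q \in <<[set p; q]>>%g by rewrite mem_gen ?set22.
apply: component_eq.
- by rewrite groupV gP.
- by rewrite -(mulKVg A B) groupM ?gP ?gQ.
- by rewrite -groupV gP.
have -> : A = (B * R0^-1)%g by rewrite /R0 /cutR invMg invgK mulKVg.
by rewrite groupM ?gP ?gQ.
Qed.

Let R0_comp x y : y \in component R0^-1 B x -> R0 y \in component R0^-1 B x.
Proof. by rewrite compE; apply: component_P. Qed.
Let A_comp x y : y \in component R0^-1 B x -> A y \in component R0^-1 B x.
Proof. by rewrite compE; apply: component_Q. Qed.
Let B_comp x y : y \in component R0 A x -> B y \in component R0 A x.
Proof. by rewrite -compE; apply: component_Q. Qed.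

(** L and F only add the transpositions (r a) and (r b) to A and B. *)
Let cover y : [|| y == r, y \in Ca | y \in Cb].
Proof.
pose S := r |: (Ca :|: Cb); suff: y \in S by rewrite !inE.
have Sr : r \in S by rewrite !inE eqxx.
have Sa : a \in S by rewrite !inE component_id orbT.
have Sb : b \in S by rewrite !inE component_id !orbT.
have SA z : z \in S -> A z \in S.
  rewrite !inE => /or3P[/eqP->|/A_comp->|/component_Q->]; rewrite ?orbT //.
  by rewrite Ar eqxx.
have SB z : z \in S -> B z \in S.
  rewrite !inE => /or3P[/eqP->|/component_Q->|/B_comp->]; rewrite ?orbT //.
  by rewrite Br eqxx.
have SL z : z \in S -> Lperm M z \in S.
  by move=> zS; rewrite Lperm_cut permM tperm_closed ?SA.
have SF z : z \in S -> Fperm M z \in S.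
  by move=> zS; rewrite Fperm_cut permM tperm_closed ?SB.
apply: (dart_ind (x := r) (Pr := fun z => z \in S)) => // z zS.
  rewrite -(permKV (Lperm M) z) -permM SF //.
  by apply: (perm_closedV SL); rewrite permKV.
Qed.

Let marked_vertex V : V \in marked M ->
  exists2 z, V = porbit (Rperm M) z & z \notin porbit (Rperm M) r.
Proof.
move=> Vm; have [z eV zr] := @smarked_vertex (NE M) V Vm.
by exists z => //; apply: (zr r).
Qed.

Let untouched_R z : z \notin touched r a b A B -> porbit (Rperm M) z = porbit R0 z.
Proof. by move=> zU; rewrite Rperm_cut (porbit_untouched Ar Br zU). Qed.

Let joined_marked (J : a != r -> b \notin porbit R0 a) V : V \in marked M ->
  exists z, [/\ V = porbit R0 z, z != r, z \notin porbit R0 a & z \notin porbit R0 b].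
Proof.
move/marked_vertex=> [z ->]; rewrite {1}Rperm_cut (porbit_root_joined Ar Br J) => zU.
exists z; rewrite untouched_R //; move: zU.
by rewrite !inE !negb_or => /and3P[zr za zb].
Qed.

Let porbit_Ca : {subset porbit R0 a <= Ca}.
Proof.
apply: porbit_ind => [|y _]; first exact: component_id.
exact: R0_comp.
Qed.

Lemma decompose_disconnected : ~~ connected -> exists m s1 s2, splits M m s1 s2.
Proof.
rewrite negb_and negbK => nconn.
have J : a != r -> b \notin porbit R0 a.
  move=> ar; move: nconn; rewrite (negPf ar) /=.
  by apply: contra; apply: porbit_Ca.
have dis y : y != r -> y \in Ca -> y \notin Cb.
  move=> yr ya; apply/negP=> yb; case/orP: nconn => [/eqP ar|].
    move: ya; rewrite /Ca /a ar /component orbit_sym => /(component_fixed R0Vr Br) ey.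
    by rewrite ey eqxx in yr.
  case/negP; rewrite -/R0 -/B; move: yb; rewrite /Cb -compE /component orbit_sym => yb.
  exact: orbit_trans yb ya.
pose p (V : {set M}) := V \subset Ca.
have subCa z : p (porbit R0 z) = (z \in Ca).
  apply/subsetP/idP => [->//|za]; first exact: porbit_id.
  by apply: porbit_ind => // y _; apply: R0_comp.
have m1P V : V \in filter p (marked M) ->
    exists2 y, y \in Ca & V = porbit (R0^-1)%g y.
  rewrite mem_filter => /andP[pV /(joined_marked J)[z [eV _ _ _]]].
  by exists z; rewrite ?porbitV // -subCa -eV.
have m2P V : V \in filter (predC p) (marked M) ->
    exists2 y, y \in Cb & V = porbit R0 y.
  rewrite mem_filter => /andP[/= pV /(joined_marked J)[z [eV zr _ _]]].
  exists z => //; have := cover z; rewrite (negPf zr) -subCa -eV (negPf pV).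
  by [].
have ma1 : porbit R0^-1 a \notin filter p (marked M).
  rewrite mem_filter; apply/negP=> /andP[_ /(joined_marked J)[z [eV _ /negP za _]]].
  by apply: za; rewrite porbit_sym -eq_porbit_mem -eV porbitV.
have mb1 : porbit R0 b \notin filter (predC p) (marked M).
  rewrite mem_filter; apply/negP=> /andP[_ /(joined_marked J)[z [eV _ _ /negP zb]]].
  by apply: zb; rewrite porbit_sym -eq_porbit_mem -eV.
have [s1 [j1 [pj1 jm1 sur1]]] :=
  seq_component_placed R0Vr Br (filter_uniq _ (marked_uniq M)) ma1 m1P.
have [s2 [j2 [pj2 jm2 sur2]]] :=
  seq_component_placed R0r Ar (filter_uniq _ (marked_uniq M)) mb1 m2P.
have inCa u : j1 u \in Ca.
  elim/seq_dart_ind: u => [x rx|u uC|u uC]; case: pj1 => _ _ jR jL jx.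
  - by move: jx; rewrite rx /= => ->; apply: component_id.
  - by rewrite jR component_P.
  by rewrite jL component_Q.
have inCb u : j2 u \in Cb.
  elim/seq_dart_ind: u => [x rx|u uC|u uC]; case: pj2 => _ _ jR jL jx.
  - by move: jx; rewrite rx /= => ->; apply: component_id.
  - by rewrite jR component_P.
  by rewrite jL component_Q.
have gl : gluing (root2 s1 s2) (glue_map r j1 j2).
  apply: (placed_gluing pj1 pj2).
  - move=> u v euv; case: pj1 => _ /(_ u) ur _ _ _.
    by have := dis _ ur (inCa u); rewrite euv inCb.
  - move=> y yr; have := cover y; rewrite (negPf yr) /= => /orP[yC|yC].
      by left; apply: sur1.
    by right; apply: sur2.
  by case: pj2 => _ _ _ _; rewrite -/b => <-; rewrite /root2; case: (sroot s2).
pose m := map p (marked M).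
have sj1 := congr1 size jm1; have sj2 := congr1 size jm2.
rewrite !size_map !size_filter in sj1 sj2.
have [|| ms [sm m1 m2]] := @mask_merge _ m
  (push (@lift1 (darts s1) (darts s2)) (smarked s1))
  (push (@lift2 (darts s1) (darts s2)) (smarked s2)).
- by rewrite count_map size_map sj1; apply: eq_count.
- by rewrite count_map size_map sj2; apply: eq_count.
exists m, s1, s2, ms; split=> //; exists (glue_map r j1 j2) => //.
apply: (@mask_comask_inj _ m).
- by rewrite [RHS]size_map -sm.
- by rewrite size_map.
- rewrite -map_mask m1 -/(push _ _) -push_comp -filter_mask -jm1.
  exact: eq_push.
rewrite -map_comask m2 -/(push _ _) -push_comp comask_map -jm2.
exact: eq_push.
Qed.

(** If the component of a contains all darts but the root, it is the only piece.
    Its distinguished vertices may be any R0-cycles other than that of a. *)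
Lemma connected_gluing ms : connected -> uniq ms -> porbit R0 a \notin ms ->
  (forall V, V \in ms -> exists2 z, z != r & V = porbit R0 z) ->
  exists (h : marked_hypermap) (u : h) io,
    @gluing (NE h) EE (single u) M io /\ push io (push (@single h) (marked h)) = ms.
Proof.
move=> /andP[ar bCa] Ums msa msP.
have full y : y != r -> y \in Ca.
  move=> yr; have := cover y; rewrite (negPf yr) /= => /orP[//|].
  by rewrite /Cb -compE => yb; apply: orbit_trans yb bCa.
have ms1P V : V \in ms -> exists2 y, y \in Ca & V = porbit (R0^-1)%g y.
  by move/msP=> [z zr ->]; exists z; rewrite ?porbitV // full.
have msa1 : porbit R0^-1 a \notin ms by rewrite porbitV.
have [s [j [pj jm sur]]] := seq_component_placed R0Vr Br Ums msa1 ms1P.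
case: s j pj jm sur => [|h] j pj jm sur.
  by case: pj => _ _ _ _ /= era; case/eqP: ar; rewrite -/r era.
have br : b != r.
  apply/eqP=> br; rewrite /= -/b br in bCa; case/eqP: ar.
  exact: component_fixed R0Vr Br bCa.
have [u ju] := sur b br bCa.
exists h, u, (glue_map r j (fun v : void => match v with end)); split; last first.
  by rewrite -push_comp -jm; apply: eq_push.
apply: (placed_gluing (s2 := EE) (x2 := r) pj) => //; first by split=> //=; case.
by move=> y yr; left; apply: sur; rewrite ?full.
Qed.

Lemma decompose_vertex : connected -> b \notin porbit R0 a ->
  exists h i, splits_vertex M h i.
Proof.
move=> conn ba; have J : a != r -> b \notin porbit R0 a by [].
have br : b != r.
  case/andP: conn => ar bCa; apply/eqP=> br; rewrite -/b br in bCa.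
  by case/eqP: ar; apply: component_fixed R0Vr Br bCa.
have [||V /predU1P[->|/(joined_marked J)[z [-> zr _ _]]]|h [u [io [gl em]]]] :=
    @connected_gluing (porbit R0 b :: marked M) conn.
- rewrite /= marked_uniq andbT; apply/negP=> /(joined_marked J)[z [eV _ _ /negP[]]].
  by rewrite porbit_sym -eq_porbit_mem eV.
- rewrite inE negb_or eq_porbit_mem porbit_sym ba /=.
  apply/negP=> /(joined_marked J)[z [eV _ /negP[]]].
  by rewrite porbit_sym -eq_porbit_mem eV.
- by exists b.
- by exists z.
case ehm: (marked h) em => [|V vs] //= [eV evs].
have io_i := gluing_inj gl; have iob := gluing_at gl.
have [v eVv _] : exists2 v, V = porbit (Rperm h) v & true.
  have /(@smarked_vertex (NE h))[v -> _] : V \in smarked (NE h).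
    by rewrite /= ehm mem_head.
  by exists v.
have uV : u \in V.
  rewrite -(mem_imset _ _ (@single_inj h)) -(mem_imset _ _ io_i) eV iob.
  exact: porbit_id.
have [y yent] := is_entry_exists uV.
have [_ [_ yV _]] := yent.
have /porbit_iterP[i iV eu] : u \in porbit (Rperm h) y.
  by move: yV uV; rewrite eVv -!eq_porbit_mem => /eqP-> /eqP->.
exists h, i, V, vs, y; split=> //.
  move: yV iV; rewrite eVv -eq_porbit_mem => /eqP->.
  by [].
by rewrite -eu; exists io.
Qed.

Let cut_marked k V : a != r -> k < #|porbit R0 b| -> iter k R0 b = a ->
  V \in marked M -> V != porbit (Rperm M) a ->
  exists2 z, z != r /\ z \notin porbit R0 a & V = porbit R0 z.
Proof.
move=> ar km ka /marked_vertex[z -> zr].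
rewrite eq_porbit_mem => za.
have zU : z \notin touched r a b A B.
  by rewrite (touched_cut Ar Br ar km ka) -/A -/B -(Rperm_cut M) inE negb_or zr za.
exists z; last exact: untouched_R.
by move: zU; rewrite !inE !negb_or => /and3P[-> -> _].
Qed.

Let connected_step ms : connected -> b \in porbit R0 a -> uniq ms ->
  (forall V, V \in ms -> V \in marked M /\ V != porbit (Rperm M) a) ->
  exists (h : marked_hypermap) k io, [/\ k < #|porbit (Rperm h) (Defs.root h)|,
    @gluing (NE h) EE (root_step h k) M io & push io (push (@single h) (marked h)) = ms].
Proof.
move=> conn ba Ums msP; have /andP[ar _] := conn.
have ab : a \in porbit R0 b by rewrite porbit_sym.
have /porbit_iterP[k0 km ka] := ab.
have msz V : V \in ms -> exists2 z, z != r /\ z \notin porbit R0 a & V = porbit R0 z.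
  by move/msP=> [Vm Va]; apply: cut_marked km (esym ka) Vm Va.
have [|V /msz[z [zr _] ->]|h [u [io [gl em]]]] := @connected_gluing ms conn Ums.
- apply/negP=> /msz[z [_ za] eV]; case/negP: za.
  by rewrite porbit_sym -eq_porbit_mem eV.
- by exists z.
have io_i := gluing_inj gl.
have /porbit_iterP[k kh eu] : u \in porbit (Rperm h) (Defs.root h).
  have: single u \in porbit (sepR (NE h) EE) (root1 (NE h) EE).
    rewrite -(mem_imset _ _ io_i) (gluing_porbit_sepR gl) (gluing_root1 gl) (gluing_at gl).
    exact: ba.
  by case/mem_porbit_root1=> // x [<-] [v vx [->]].
by exists h, k, io; split=> //; rewrite /root_step -eu.
Qed.

Lemma decompose_unmarked : connected -> b \in porbit R0 a ->
  porbit (Rperm M) a \notin marked M -> exists h k, merges_unmarked M h k.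
Proof.
move=> conn ba Pam.
have [V Vm|h [k [io [kh gl em]]]] := connected_step conn ba (marked_uniq M).
  by split=> //; apply: contraNneq Pam => <-.
by exists h, k; split=> //; exists io.
Qed.

Lemma decompose_marked : connected -> b \in porbit R0 a ->
  porbit (Rperm M) a \in marked M -> exists h j k, merges_marked M h j k.
Proof.
move=> conn ba Pam; pose Pa := porbit (Rperm M) a.
pose j := index Pa (marked M); pose ms := remove_nth j (marked M).
have jm : j < size (marked M) by rewrite index_mem.
have insms : insert j Pa ms = marked M.
  by have := insert_remove Pa jm; rewrite nth_index.
have /andP[Pams Ums] : uniq (Pa :: ms).
  by rewrite -(perm_uniq (perm_insert j Pa ms)) insms marked_uniq.
have [V Vms|h [k [io [kh gl em]]]] := connected_step conn ba Ums.
  split; last by apply: contraNneq Pams => eV; rewrite /Pa -eV.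
  by rewrite -insms (perm_mem (perm_insert j Pa ms)) inE Vms orbT.
exists h, j, k; split=> //.
  have := congr1 size em; rewrite !size_map => ->.
  by rewrite -ltnS size_remove_nth.
exists io => //; rewrite push_insert em (gluing_porbit gl) (gluing_root1 gl).
exact: insms.
Qed.

End Decompose.

(** * Uniqueness of the decomposition *)

Lemma splits_iso M m s1 s2 s1' s2' : seq_iso s1 s1' -> seq_iso s2 s2' ->
  splits M m s1 s2 -> splits M m s1' s2'.
Proof.
move=> /seq_isoP[phi1 m1 e1] /seq_isoP[phi2 m2 e2] [ms [gm sm ms1 ms2]].
exists (push (both phi1 phi2) ms); split.
- by rewrite -(both_root2 phi1 m2); apply: glued_transport.
- by rewrite size_map.
- by rewrite -map_mask ms1 -/(push _ _) push_both_lift1 e1.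
by rewrite -map_comask ms2 -/(push _ _) push_both_lift2 e2.
Qed.

Section SingleIso.

Variables (h h' : marked_hypermap) (phi : darts (NE h) -> darts (NE h')).
Hypotheses (mphi : @seq_morph (NE h) (NE h') phi)
  (phim : push phi (marked h) = marked h').

Let up := both phi (@id (darts EE)).

Lemma single_transport u M ms : glued (single u) M ms ->
  glued (@single h' (phi u)) M (push up ms).
Proof. exact: (glued_transport mphi (seq_morph_id EE)). Qed.

Lemma push_single_transport ms :
  push up (push (@single h) ms) = push (@single h') (push phi ms).
Proof. exact: push_both_lift1. Qed.

Lemma iter_transport k u : phi (iter k (Rperm h) u) = iter k (Rperm h') (phi u).
Proof. by case: mphi => _ phiR _ _; elim: k => //= k <-; apply: phiR. Qed.

Lemma root_transport : phi (Defs.root h) = Defs.root h'.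
Proof. by case: mphi => _ _ _ []. Qed.

Lemma root_porbit_transport :
  #|porbit (Rperm h) (Defs.root h)| = #|porbit (Rperm h') (Defs.root h')|.
Proof.
case: mphi => /bij_inj phi_i phiR _ _; rewrite -root_transport.
by rewrite -(imset_porbit phiR) card_imset.
Qed.

Lemma splits_vertex_transport M i : splits_vertex M h i -> splits_vertex M h' i.
Proof.
move=> [V [vs [y [em yent iV gm]]]].
exists (phi @: V)%SET, (push phi vs), (phi y); split.
- by rewrite -phim em.
- exact: is_entry_iso.
- by rewrite card_imset //; case: mphi => /bij_inj.
by rewrite -iter_transport -push_single_transport; apply: single_transport.
Qed.

Lemma root_step_transport k :
  single (phi (iter k (Rperm h) (Defs.root h))) = root_step h' k.
Proof. by rewrite iter_transport root_transport. Qed.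

Lemma merges_unmarked_transport M k : merges_unmarked M h k -> merges_unmarked M h' k.
Proof.
move=> [kh gm]; split; first by rewrite -root_porbit_transport.
by rewrite -root_step_transport -phim -push_single_transport; apply: single_transport.
Qed.

Lemma merges_marked_transport M j k : merges_marked M h j k -> merges_marked M h' j k.
Proof.
move=> [kh jh gm]; split; first by rewrite -root_porbit_transport.
  by rewrite -phim size_map.
have := single_transport gm; rewrite push_insert push_single_transport phim.
rewrite (imset_porbit (both_glueR mphi (seq_morph_id EE) _)).
by rewrite (both_root1 (@id (darts EE)) mphi) /= -/(single _) root_step_transport.
Qed.

End SingleIso.

Lemma splits_vertex_iso M h h' i : seq_iso (NE h) (NE h') ->
  splits_vertex M h i -> splits_vertex M h' i.
Proof.
by move=> /seq_isoP[phi mphi phim]; apply: (splits_vertex_transport mphi phim).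
Qed.

Lemma merges_unmarked_iso M h h' k : seq_iso (NE h) (NE h') ->
  merges_unmarked M h k -> merges_unmarked M h' k.
Proof.
by move=> /seq_isoP[phi mphi phim]; apply: (merges_unmarked_transport mphi phim).
Qed.

Lemma merges_marked_iso M h h' j k : seq_iso (NE h) (NE h') ->
  merges_marked M h j k -> merges_marked M h' j k.
Proof.
by move=> /seq_isoP[phi mphi phim]; apply: (merges_marked_transport mphi phim).
Qed.

Lemma splits_det M M' m s1 s2 : splits M m s1 s2 -> splits M' m s1 s2 -> marked_iso M M'.
Proof.
move=> [ms [gm sm m1 m2]] [ms' [gm' sm' m1' m2']].
suff ems : ms = ms' by rewrite -ems in gm'; apply: glued_det gm gm'.
by apply: (mask_comask_inj sm sm'); rewrite ?m1 ?m2.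
Qed.

Lemma splits_vertex_det M M' h i :
  splits_vertex M h i -> splits_vertex M' h i -> marked_iso M M'.
Proof.
move=> [V [vs [y [em yent iV gm]]]] [V' [vs' [y' [em' yent' iV' gm']]]].
move: em'; rewrite em => -[eV evs]; rewrite -{}eV -{}evs in yent' gm'.
by rewrite (is_entry_uniq yent' yent) in gm'; apply: glued_det gm gm'.
Qed.

Lemma merges_unmarked_det M M' h k :
  merges_unmarked M h k -> merges_unmarked M' h k -> marked_iso M M'.
Proof. by move=> [_ gm] [_ gm']; apply: glued_det gm gm'. Qed.

Lemma merges_marked_det M M' h j k :
  merges_marked M h j k -> merges_marked M' h j k -> marked_iso M M'.
Proof. by move=> [_ _ gm] [_ _ gm']; apply: glued_det gm gm'. Qed.

(** The mask is recovered from M as the set of positions of the distinguished vertices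
    which meet the image of the first piece. *)
Lemma splits_uniq M m m' s1 s2 s1' s2' :
  splits M m s1 s2 -> splits M m' s1' s2' ->
  [/\ m = m', seq_iso s1 s1' & seq_iso s2 s2'].
Proof.
move=> [ms [[io gl iom] sm m1 m2]] [ms' [[io' gl' iom'] sm' m1' m2']].
have [phi1 mphi1 e1] := placed_uniq (gluing_placed1 gl) (gluing_placed1 gl').
have [phi2 mphi2 e2] :=
  placed_uniq (gluing_placed2 gl erefl) (gluing_placed2 gl' erefl).
have maskM n (t1 t2 : seq_hypermap) (i : option (darts t1 + darts t2) -> M) l :
    push i l = marked M -> mask n (marked M) = push i (mask n l).
  by move=> <-; rewrite -map_mask.
have comaskM n (t1 t2 : seq_hypermap) (i : option (darts t1 + darts t2) -> M) l :
    push i l = marked M -> co_mask n (marked M) = push i (co_mask n l).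
  by move=> <-; rewrite -map_comask.
have em : m = m'.
  (* A vertex of M comes from the first piece if some dart of that piece is in it. *)
  pose p (t1 t2 : seq_hypermap) (i : option (darts t1 + darts t2) -> M)
    (V : {set M}) := [exists u : darts t1, i (lift1 u) \in V].
  have mP t1 t2 (i : option (darts t1 + darts t2) -> M) n l : injective i ->
     push i l = marked M -> size n = size l ->
     mask n l = push lift1 (smarked t1) -> co_mask n l = push lift2 (smarked t2) ->
     n = map (p t1 t2 i) (marked M).
    move=> ii il sn n1 n2; apply: mask_determined.
    - by rewrite -il size_map.
    - rewrite (maskM _ _ _ _ _ il) n1; apply/allP=> _ /mapP[_ /mapP[V Vm ->] ->].
      have [u -> _] := smarked_vertex Vm; apply/existsP; exists u.
      by rewrite !imset_f ?porbit_id.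
    rewrite (comaskM _ _ _ _ _ il) n2; apply/allP=> _ /mapP[_ /mapP[V Vm ->] ->] /=.
    apply/existsPn=> u; rewrite mem_imset //.
    by apply/negP=> /imsetP[].
  rewrite (mP _ _ _ _ _ (gluing_inj gl) iom sm m1 m2).
  rewrite (mP _ _ _ _ _ (gluing_inj gl') iom' sm' m1' m2').
  apply: eq_map => V; have [[psi _ psiK] _ _ _] := mphi1.
  apply/existsP/existsP=> -[u uV].
    by exists (phi1 u); have := e1 u; rewrite /= => <-.
  by exists (psi u); have := e1 (psi u); rewrite /= psiK => ->.
rewrite -em in m1' m2' *; split=> //; apply/seq_isoP.
  exists phi1 => //; apply: (push_inj (f := io' \o lift1)).
    by apply: inj_comp; [apply: gluing_inj gl' | apply: lift1_inj].
  rewrite -push_comp (push_comp io' lift1) -m1' -(maskM _ _ _ _ _ iom').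
  rewrite (maskM _ _ _ _ _ iom) m1 -push_comp; apply: eq_push => v.
  exact/esym/e1.
exists phi2 => //; apply: (push_inj (f := io' \o lift2)).
  by apply: inj_comp; [apply: gluing_inj gl' | apply: lift2_inj].
rewrite -push_comp (push_comp io' lift2) -m2' -(comaskM _ _ _ _ _ iom').
rewrite (comaskM _ _ _ _ _ iom) m2 -push_comp; apply: eq_push => v.
exact/esym/e2.
Qed.

Lemma single_uniq M (h h' : marked_hypermap) (u : h) (u' : h') io io' :
  @gluing (NE h) EE (single u) M io -> @gluing (NE h') EE (single u') M io' ->
  exists phi : h -> h', [/\ @seq_morph (NE h) (NE h') phi,
    forall v, io (single v) = io' (single (phi v)), phi u = u' &
    forall vs vs', push io (push (@single h) vs) = push io' (push (@single h') vs') ->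
      push phi vs = vs'].
Proof.
move=> gl gl'.
have [phi mphi e1] := placed_uniq (gluing_placed1 gl) (gluing_placed1 gl').
have io_i' : injective (io' \o @single h').
  by apply: inj_comp; [apply: gluing_inj gl' | apply: lift1_inj].
exists phi; split=> //.
  apply: io_i'; rewrite /= (gluing_at gl') -(gluing_at gl).
  exact/esym/e1.
move=> vs vs' evs; apply: (push_inj io_i').
rewrite [RHS]push_comp -evs -!push_comp; apply: eq_push => v.
exact/esym/e1.
Qed.

(** The isomorphism of the pieces preserves b, hence the vertex of b, which is the
    first distinguished vertex; as it also preserves the canonical dart of that
    vertex, it preserves the distance i from it to b. *)
Lemma splits_vertex_uniq M h h' i i' :
  splits_vertex M h i -> splits_vertex M h' i' -> i = i' /\ seq_iso (NE h) (NE h').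
Proof.
move=> [V [vs [y [em yent iV [io gl iom]]]]] [V' [vs' [y' [em' yent' iV' [io' gl' iom']]]]].
have [phi [mphi e1 eu evs]] := single_uniq gl gl'.
have [bphi phiR phiL phir] := mphi.
have pV (g : marked_hypermap) (W : {set g}) ws z :
    marked g = W :: ws -> is_entry W z -> W = porbit (Rperm g) z.
  move=> eg [w [_ zW _]]; have : W \in smarked (NE g) by rewrite /= eg mem_head.
  move/smarked_vertex=> [v eW _]; move: zW; rewrite eW -eq_porbit_mem => /eqP <-.
  by [].
have eV : (phi @: V)%SET = V'.
  rewrite (pV _ _ _ _ em yent) (pV _ _ _ _ em' yent') (imset_porbit phiR).
  have := congr1 (porbit (Rperm h')) eu.
  by rewrite (iter_transport mphi) -!permX !porbit_perm.
have ey : phi y = y'.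
  by apply: is_entry_uniq yent'; rewrite -eV; apply: is_entry_iso.
have em2 : push phi (marked h) = marked h'.
  by rewrite em em' /= eV; congr (_ :: _); apply: evs; rewrite iom iom'.
split; last by apply/seq_isoP; exists phi.
move: eu; rewrite (iter_transport mphi) ey; apply: porbit_iter_inj.
  by rewrite -(pV _ _ _ _ em' yent') -eV card_imset //; apply: bij_inj.
by rewrite -(pV _ _ _ _ em' yent').
Qed.

Lemma merges_unmarked_uniq M h h' k k' :
  merges_unmarked M h k -> merges_unmarked M h' k' -> seq_iso (NE h) (NE h').
Proof.
move=> [kh [io gl iom]] [kh' [io' gl' iom']].
have [phi [mphi e1 eu evs]] := single_uniq gl gl'.
by apply/seq_isoP; exists phi => //; apply: evs; rewrite iom iom'.
Qed.

Lemma merges_marked_index M h j k : merges_marked M h j k ->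
  j = index (porbit (Rperm M) (root_L M)) (marked M) /\ j < size (marked M).
Proof.
move=> [kh jh [io gl iom]]; have io_i := gluing_inj gl.
have sj : j < size (marked M).
  by rewrite -iom size_map size_insert ltnS size_map.
split=> //; rewrite -(gluing_root1 gl) -(gluing_porbit gl).
set W := porbit _ _ in iom *.
have eW : nth (io @: W)%SET (marked M) j = (io @: W)%SET.
  by rewrite -iom push_insert nth_insert // !size_map.
by rewrite -eW index_uniq // marked_uniq.
Qed.

Lemma merges_marked_uniq M h h' j j' k k' :
  merges_marked M h j k -> merges_marked M h' j' k' ->
  j = j' /\ seq_iso (NE h) (NE h').
Proof.
move=> mm mm'; have [ej _] := merges_marked_index mm.
have [ej' _] := merges_marked_index mm'; rewrite -ej in ej'.
move: mm mm' => [kh jh [io gl iom]] [kh' jh' [io' gl' iom']].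
have [phi [mphi e1 eu evs]] := single_uniq gl gl'.
split=> //; apply/seq_isoP; exists phi => //; apply: evs.
rewrite ej' in jh' iom'.
have := congr1 (remove_nth j) (etrans iom (esym iom')).
by rewrite !push_insert !insertK // !size_map.
Qed.

Lemma splits_disconnected M m s1 s2 : splits M m s1 s2 -> ~~ connected M.
Proof.
move=> [ms [[io gl iom] sm m1 m2]]; rewrite /connected.
have [_ _ jR jL jx] := gluing_placed1 gl.
rewrite -(gluing_at gl); case e1: (sroot s1) jx => [x|] /= <-; last by rewrite eqxx.
apply/nandP; right; apply/negP=> bC.
have : exists u, io (root2 s1 s2) = io (lift1 u).
  move: bC; move: (io (root2 s1 s2)); apply: component_ind.
  - by exists x.
  - by move=> _ _ [u ->]; exists (sR s1 u); rewrite -jR.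
  by move=> _ _ [u ->]; exists (sL s1 u); rewrite -jL.
by case=> u /(gluing_inj gl); rewrite /root2; case: (sroot s2).
Qed.

Lemma gluing_connected M (h : marked_hypermap) (u : h) io :
  @gluing (NE h) EE (single u) M io -> connected M.
Proof.
move=> gl; rewrite /connected; have [_ jr jR jL jx] := gluing_placed1 gl.
rewrite -jx -(gluing_at gl) /= jr /=.
have allC : forall v : h, io (lift1 v) \in
    component (cutR M)^-1 (cutF M) (io (@lift1 (darts (NE h)) (darts EE) (Defs.root h))).
  apply: (dart_ind (x := Defs.root h)); first exact: component_id.
    by move=> v vC; rewrite [io _]jR component_P.
  by move=> v vC; rewrite [io _]jL component_Q.
exact: allC.
Qed.

Lemma gluing_vertex M (h : marked_hypermap) (u : h) io :
  @gluing (NE h) EE (single u) M io ->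
  (root_F M \in porbit (cutR M) (root_L M)) =
  (single u \in porbit (sepR (NE h) EE) (root1 (NE h) EE)).
Proof.
move=> gl; rewrite -(gluing_at gl) -(gluing_root1 gl) -(gluing_porbit_sepR gl).
by rewrite mem_imset //; apply: gluing_inj gl.
Qed.

Lemma splits_vertex_kind M h i : splits_vertex M h i ->
  connected M /\ root_F M \notin porbit (cutR M) (root_L M).
Proof.
move=> [V [vs [y [em [w [_ yV _]] iV [io gl iom]]]]].
split; first exact: gluing_connected gl.
by rewrite (gluing_vertex gl) (entry_disjoint i em yV).
Qed.

Lemma merges_unmarked_kind M h k : merges_unmarked M h k ->
  [/\ connected M, root_F M \in porbit (cutR M) (root_L M)
    & porbit (Rperm M) (root_L M) \notin marked M].
Proof.
move=> [kh [io gl iom]]; split; first exact: gluing_connected gl.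
  by rewrite (gluing_vertex gl) cut_b.
rewrite -(gluing_root1 gl) -(gluing_porbit gl) -iom mem_map; last first.
  exact/imset_inj/(gluing_inj gl).
apply/negP=> /single_marked[u [eW ua _ _]]; move: ua.
by rewrite porbit_sym -eW porbit_id.
Qed.

Lemma merges_marked_kind M h j k : merges_marked M h j k ->
  [/\ connected M, root_F M \in porbit (cutR M) (root_L M)
    & porbit (Rperm M) (root_L M) \in marked M].
Proof.
move=> mm; have [ej jm] := merges_marked_index mm.
case: mm => [kh jh [io gl iom]]; split; first exact: gluing_connected gl.
  by rewrite (gluing_vertex gl) cut_b.
by rewrite -index_mem -ej.
Qed.

(** * Genus, isomorphism classes and the bijection *)

Local Open Scope ring_scope.

Lemma has_genus_uniq s (g g' : int) : has_genus s g -> has_genus s g' -> g = g'.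
Proof. by rewrite /has_genus; lia. Qed.

(** Additivity follows from Euler's formula, as the glued hypermap has one dart more
    and one vertex less than both pieces together, and the same total number of
    hyperedges and faces. *)
Lemma splits_genus M m s1 s2 (g1 g2 : int) : splits M m s1 s2 ->
  has_genus s1 g1 -> has_genus s2 g2 -> has_genus (NE M) (g1 + g2).
Proof.
move=> /splits_counts[[c1 c2 c3 c4 c5] _]; rewrite /has_genus.
lia.
Qed.

Lemma splits_vertex_genus M h i (g : int) : splits_vertex M h i ->
  has_genus (NE M) g <-> has_genus (NE h) (g - 1).
Proof.
move=> /splits_vertex_counts[c1 c2 c3 c4 _].
by rewrite /has_genus; lia.
Qed.

Lemma merges_unmarked_genus M h k (g : int) : merges_unmarked M h k ->
  has_genus (NE M) g <-> has_genus (NE h) g.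
Proof.
move=> /merges_unmarked_counts[[c1 c2 c3 c4 _] _].
by rewrite /has_genus; lia.
Qed.

Lemma merges_marked_genus M h j k (g : int) : merges_marked M h j k ->
  has_genus (NE M) g <-> has_genus (NE h) g.
Proof.
move=> /merges_marked_counts[[c1 c2 c3 c4 _] _].
by rewrite /has_genus; lia.
Qed.

Variant removal_case (M : marked_hypermap) : Prop :=
  | CaseSplits m s1 s2 of splits M m s1 s2
  | CaseVertex h i of splits_vertex M h i
  | CaseUnmarked h k of merges_unmarked M h k
  | CaseMarked h j k of merges_marked M h j k.

Lemma removal_caseP M : removal_case M.
Proof.
have [conn|nconn] := boolP (connected M); last first.
  by have [m [s1 [s2 H]]] := decompose_disconnected nconn; apply: CaseSplits H.
have [ba|nba] := boolP (root_F M \in porbit (cutR M) (root_L M)); last first.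
  by have [h [i H]] := decompose_vertex conn nba; apply: CaseVertex H.
have [am|nam] := boolP (porbit (Rperm M) (root_L M) \in marked M).
  by have [h [j [k H]]] := decompose_marked conn ba am; apply: CaseMarked H.
by have [h [k H]] := decompose_unmarked conn ba nam; apply: CaseUnmarked H.
Qed.

(** The genus is a nonnegative integer: removing the root yields smaller hypermaps
    from whose genera the genus is obtained by addition, possibly adding 1. *)
Lemma genus_exists s : exists2 g : int, 0 <= g & has_genus s g.
Proof.
have [n] := ubnP (ndarts s); elim: n s => // n IHn [|M] ltMn.
  by exists 0.
case: (removal_caseP M) => [m s1 s2 H|h i H|h k H|h j k H].
- have [[c1 _ _ _ _] _] := splits_counts H.
  have [|g1 g1_ge0 hg1] := IHn s1; first by lia.
  have [|g2 g2_ge0 hg2] := IHn s2; first by lia.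
  by exists (g1 + g2); [lia | apply: splits_genus H hg1 hg2].
- have [c1 _ _ _ _] := splits_vertex_counts H.
  have [|g g_ge0 hg] := IHn (NE h); first by lia.
  exists (g + 1); first by lia.
  apply/(splits_vertex_genus _ H).
  by rewrite (_ : g + 1 - 1 = g) //; lia.
- have [[c1 _ _ _ _] _] := merges_unmarked_counts H.
  have [|g g_ge0 hg] := IHn (NE h); first by lia.
  by exists g => //; apply/(merges_unmarked_genus _ H).
have [[c1 _ _ _ _] _] := merges_marked_counts H.
have [|g g_ge0 hg] := IHn (NE h); first by lia.
by exists g => //; apply/(merges_marked_genus _ H).
Qed.

Lemma genus_ge0 s (g : int) : has_genus s g -> 0 <= g.
Proof.
by have [g' g'_ge0 hg'] := genus_exists s => hg; rewrite (has_genus_uniq hg hg').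
Qed.

Definition has_type (s : seq_hypermap) (g t f e n : int) (D : seq int) : Prop :=
  [/\ 0 <= g /\ has_genus s g, (ndarts s)%:Z = t,
      (nfaces s)%:Z = f /\ (nhyperedges s)%:Z = e, (root_degree s)%:Z = n
    & [seq d%:Z | d <- marked_degrees s] = D].

Lemma seq_iso_counts s s' : seq_iso s s' ->
  [/\ ndarts s = ndarts s', nfaces s = nfaces s',
      nhyperedges s = nhyperedges s', nvertices s = nvertices s' &
      root_degree s = root_degree s' /\ marked_degrees s = marked_degrees s'].
Proof.
move=> /seq_isoP[phi [bphi phiR phiL phir] phim]; have phi_i := bij_inj bphi.
have emp : is_empty s = is_empty s' by rewrite /is_empty -phir; case: (sroot s).
have phiF x : phi (sF s x) = sF s' (phi x) by rewrite !permM phiR phiL.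
split.
- by rewrite !ndartsE (bij_eq_card bphi).
- by rewrite !nfacesE emp (card_porbits_bij bphi phiF).
- by rewrite !nhyperedgesE (card_porbits_bij bphi phiL).
- by rewrite !nverticesE emp (card_porbits_bij bphi phiR).
split; last by rewrite !marked_degreesE -phim card_push.
rewrite !root_degreeE -phir; case: (sroot s) => //= x.
by rewrite -(imset_porbit phiR) card_imset.
Qed.

Lemma has_type_iso s s' g t f e n D : seq_iso s s' ->
  has_type s g t f e n D -> has_type s' g t f e n D.
Proof.
move=> /seq_iso_counts[e1 e2 e3 e4 [e5 e6]].
by rewrite /has_type /has_genus e1 e2 e3 e4 e5 e6.
Qed.

Section Classes.

Variables (g t f e n : int) (D : seq int).
Implicit Types x y : hypermaps g t f e n D.

Lemma mem_exists x : exists s, sval x s.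
Proof. by case: x => C [s [eC ?]]; exists s; rewrite /= eC; apply: seq_iso_refl. Qed.

Lemma mem_type x s : sval x s -> has_type s g t f e n D.
Proof. by case: x => C [s' [eC T]] /=; rewrite eC => /has_type_iso; apply. Qed.

Lemma mem_iso x s s' : sval x s -> sval x s' -> seq_iso s s'.
Proof.
case: x => C [s0 [eC T]] /=; rewrite eC => i; apply: seq_iso_trans.
exact: seq_iso_sym.
Qed.

Lemma mem_closed x s s' : sval x s -> seq_iso s s' -> sval x s'.
Proof. by case: x => C [s0 [eC T]] /=; rewrite eC; apply: seq_iso_trans. Qed.

Lemma mem_inj x y s : sval x s -> sval y s -> x = y.
Proof.
case: x y => C [s0 [eC T]] [C' [s0' [eC' T']]] /= Cs Cs'.
have eCC : C = C'.
  apply: functional_extensionality => s1; apply: propositional_extensionality.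
  rewrite eC eC' /iso_class in Cs Cs' *; split=> i.
    exact: seq_iso_trans Cs' (seq_iso_trans (seq_iso_sym Cs) i).
  exact: seq_iso_trans Cs (seq_iso_trans (seq_iso_sym Cs') i).
rewrite -eCC in eC' *; congr exist; exact: proof_irrelevance.
Qed.

Lemma mem_make s : has_type s g t f e n D -> exists x, sval x s.
Proof.
move=> T; exists (exist _ (iso_class s) (ex_intro _ s (conj erefl T))).
exact: seq_iso_refl.
Qed.

End Classes.

Lemma int_range_eq (a b : int) (p q : int_range a b) : sval p = sval q -> p = q.
Proof.
case: p q => [p pp] [q qq] /= epq; subst q; congr exist.
exact: bool_irrelevance.
Qed.

Section Removal.

Variables (g t f e n : int) (D : seq int).

(** The correspondence of the theorem, on representatives of the classes. In the second
    summand, numbers from 1 to p encode the distances 0 to p - 1; in the third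
    and fourth, the distance k is determined by the degrees. *)
Definition removes (s : seq_hypermap) (d : decomposition g t f e n D) : Prop :=
  match s, d with
  | EE, inr _ => True
  | NE M, inl (inl (inl (inl (existT sp (existT m (x1, x2)))))) =>
      exists s1 s2, [/\ sval x1 s1, sval x2 s2 & splits M m s1 s2]
  | NE M, inl (inl (inl (inr (existT p (x, q))))) =>
      exists h i, [/\ sval x (NE h), splits_vertex M h i & sval q = i.+1%:Z]
  | NE M, inl (inl (inr (existT p x))) =>
      exists h k, [/\ sval x (NE h), merges_unmarked M h k
                    & sval p = n + k%:Z]
  | NE M, inl (inr (existT j x)) =>
      exists h k, [/\ sval x (NE h), merges_marked M h j k & D`_j = k.+1%:Z]
  | _, _ => False
  end.

Lemma removes_iso s s' d : seq_iso s s' -> removes s d -> removes s' d.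
Proof.
case: s s' d => [|M] [|M'] //= [[[[[sp [m [x1 x2]]]|[p [x q]]]|[p x]]|[j x]]|?] //= i.
- by move=> [s1 [s2 [y1 y2 [ms [gm *]]]]]; exists s1, s2; split=> //;
     exists ms; split=> //; apply: glued_iso gm i.
- by move=> [h [k [y [V [vs [z [? ? ? gm]]]] ?]]]; exists h, k; split=> //;
     exists V, vs, z; split=> //; apply: glued_iso gm i.
- by move=> [h [k [y [kh gm] ?]]]; exists h, k; split=> //;
     split=> //; apply: glued_iso gm i.
by move=> [h [k [y [kh jh gm] ?]]]; exists h, k; split=> //;
   split=> //; apply: glued_iso gm i.
Qed.

Lemma removes_inj s s' d : removes s d -> removes s' d -> seq_iso s s'.
Proof.
case: s s' d => [|M] [|M'] //= [[[[[sp [m [x1 x2]]]|[p [x q]]]|[p x]]|[j x]]|?] //=.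
- move=> [s1 [s2 [y1 y2 H]]] [s1' [s2' [y1' y2' H']]].
  exact: (splits_det H (splits_iso (mem_iso y1' y1) (mem_iso y2' y2) H')).
- move=> [h [i [y H qi]]] [h' [i' [y' H' qi']]].
  have ei : i = i' by move: qi'; rewrite qi => -[].
  rewrite -ei in H'.
  exact: (splits_vertex_det H (splits_vertex_iso (mem_iso y' y) H')).
- move=> [h [k [y H pk]]] [h' [k' [y' H' pk']]].
  have ek : k = k' by move: pk'; rewrite pk => /addrI[].
  rewrite -ek in H'.
  exact: (merges_unmarked_det H (merges_unmarked_iso (mem_iso y' y) H')).
move=> [h [k [y H jk]]] [h' [k' [y' H' jk']]].
have ek : k = k' by move: jk'; rewrite jk => -[].
rewrite -ek in H'.
exact: (merges_marked_det H (merges_marked_iso (mem_iso y' y) H')).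
Qed.

Lemma removes_total s : has_type s g t f e n D -> exists d, removes s d.
Proof.
case: s => [|M] T.
  have eD : (g, t, f, e, n, D) = (0, 0, 1, 0, 0, [::]).
    case: T => [[_ hg] <- [<- <-] <- <-]; congr (_, _, _, _, _, _).
    by rewrite (has_genus_uniq hg (g' := 0)).
  by exists (inr (exist _ (iso_class EE) (conj erefl eD))).
have [[g_ge0 hg] et [ef ee] en eD] := T; rewrite -/(marked_degs M) in eD.
have sD : size (marked_degs M) = size D by rewrite -eD size_map.
case: (removal_caseP M) => [m s1 s2 H|h i H|h k H|h j k H].
- have [[c1 c2 c3 c4 c5] [c6 c7 c8]] := splits_counts H.
  have sm : size m == size D by rewrite c6 sD.
  have [a1 ga1 hg1] := genus_exists s1; have [a2 ga2 hg2] := genus_exists s2.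
  have eg := has_genus_uniq hg (splits_genus H hg1 hg2).
  have [eg' et' ee' ef' en'] : [/\ a1 + a2 = g,
      (ndarts s1)%:Z + (ndarts s2)%:Z = t - 1,
      (nfaces s1)%:Z + (nhyperedges s2)%:Z = e,
      (nfaces s2)%:Z + (nhyperedges s1)%:Z = f &
      (root_degree s1)%:Z + (root_degree s2)%:Z = n - 1].
    by split; lia.
  pose sp := Splitting eg' et' ee' ef' en'.
  have T1 : has_type s1 (g1 sp) (t1 sp) (f1 sp) (e1 sp) (n1 sp) (mask (Tuple sm) D).
    by split=> //=; rewrite -c7 map_mask eD.
  have T2 : has_type s2 (g2 sp) (t2 sp) (f2 sp) (e2 sp) (n2 sp) (co_mask (Tuple sm) D).
    by split=> //=; rewrite -c8 map_comask eD.
  have [x1 y1] := mem_make T1; have [x2 y2] := mem_make T2.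
  exists (inl (inl (inl (inl (existT _ sp (existT _ (Tuple sm) (x1, x2))))))).
  by exists s1, s2.
- have [c1 c2 c3 c4 [p [c5 ip c6]]] := splits_vertex_counts H.
  have hg' := (splits_vertex_genus g H).1 hg.
  have hn : (0 < root_degree (NE h))%N.
    by rewrite lt0n; apply: card_porbit_neq0.
  have pr : (1 <= p%:Z <= n - 2)%R by rewrite -en; apply/andP; lia.
  have ir : (1 <= i.+1%:Z <= p%:Z)%R by apply/andP; lia.
  have T1 : has_type (NE h) (g - 1) (t - 1) e f (n - 1 - p%:Z) (p%:Z :: D).
    split; first by split=> //; apply: genus_ge0 hg'.
    - lia.
    - by split; lia.
    - lia.
    by rewrite -/(marked_degs h) c5 /= eD.
  have [x y] := mem_make T1.
  exists (inl (inl (inl (inr (existT _ (exist _ p%:Z pr) (x, exist _ i.+1%:Z ir)))))).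
  by exists h, i.
- have [[c1 c2 c3 c4 c5] c6] := merges_unmarked_counts H.
  have hg' := (merges_unmarked_genus g H).1 hg.
  have rt : (root_degree (NE h) <= ndarts (NE h))%N by apply: max_card.
  have pr : n <= n + k%:Z <= t - 1 by apply/andP; lia.
  have T1 : has_type (NE h) g (t - 1) e f (n + k%:Z) D.
    by split; [|lia|split; lia|lia|rewrite -/(marked_degs h) c6].
  have [x y] := mem_make T1.
  exists (inl (inl (inr (existT _ (exist _ (n + k%:Z) pr) x)))).
  by exists h, k.
have [[c1 c2 c3 c4 c5] [jD c6 c7]] := merges_marked_counts H.
have hg' := (merges_marked_genus g H).1 hg.
rewrite sD in jD; pose j' := Ordinal jD.
have Dj : D`_j = k.+1%:Z by rewrite -eD (nth_map 0%N) ?c7 // sD.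
have T1 : has_type (NE h) g (t - 1) e f (D`_j + n - 1) (remove_nth j D).
  split=> //; [lia|by split; lia|by rewrite Dj; lia|].
  by rewrite -/(marked_degs h) c6 -eD /remove_nth map_cat map_take map_drop.
have [x y] := mem_make T1.
exists (inl (inr (existT _ j' x))).
by exists h, k.
Qed.

Definition slot (d : decomposition g t f e n D) : nat :=
  match d with
  | inl (inl (inl (inl _))) => 0
  | inl (inl (inl (inr _))) => 1
  | inl (inl (inr _)) => 2
  | inl (inr _) => 3
  | inr _ => 4
  end.

(** The case that applies to M, read off from M alone: no hypermap is in the range of
    two of the summands. *)
Definition kind (M : marked_hypermap) : nat :=
  if ~~ connected M then 0
  else if root_F M \notin porbit (cutR M) (root_L M) then 1
  else if porbit (Rperm M) (root_L M) \notin marked M then 2 else 3.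

Lemma removes_slot M d : removes (NE M) d -> slot d = kind M.
Proof.
rewrite /kind; case: d => [[[[[sp [m [x1 x2]]]|[p [x q]]]|[p x]]|[j x]]|d] //=.
- by move=> [s1 [s2 [_ _ /splits_disconnected ->]]].
- by move=> [h [i [_ /splits_vertex_kind[-> ->]]]].
- by move=> [h [i [_ /merges_unmarked_kind[-> -> ->]]]].
by move=> [h [i [_ /merges_marked_kind[-> -> ->]]]].
Qed.

Lemma splitting_eq (sp sp' : splitting g t f e n) :
  g1 sp = g1 sp' -> g2 sp = g2 sp' -> t1 sp = t1 sp' -> t2 sp = t2 sp' ->
  f1 sp = f1 sp' -> f2 sp = f2 sp' -> e1 sp = e1 sp' -> e2 sp = e2 sp' ->
  n1 sp = n1 sp' -> n2 sp = n2 sp' -> sp = sp'.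
Proof.
case: sp sp' => [G1 G2 T1 T2 F1 F2 E1 E2 N1 N2 p1 p2 p3 p4 p5].
case=> [G1' G2' T1' T2' F1' F2' E1' E2' N1' N2' p1' p2' p3' p4' p5'] /=.
move=> *; subst G1' G2' T1' T2' F1' F2' E1' E2' N1' N2'.
by congr Splitting; apply: proof_irrelevance.
Qed.

Lemma removes_det s d d' : removes s d -> removes s d' -> d = d'.
Proof.
case: s => [|M].
  case: d => [[[[[? [? [? ?]]]|[? [? ?]]]|[? ?]]|[? ?]]|d] //.
  case: d' => [[[[[? [? [? ?]]]|[? [? ?]]]|[? ?]]|[? ?]]|d'] // _ _.
  congr inr; case: d d' => [C [eC P]] [C' [eC' P']].
  by subst C C'; congr exist; apply: proof_irrelevance.
move=> rd rd'; have := removes_slot rd'; rewrite -(removes_slot rd).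
case: d rd => [[[[[sp [m [x1 x2]]]|[p [x q]]]|[p x]]|[j x]]|d] /=;
  case: d' rd' => [[[[[sp' [m' [x1' x2']]]|[p' [x' q']]]|[p' x']]|[j' x']]|d'] //=.
- move=> [s1' [s2' [y1' y2' H']]] [s1 [s2 [y1 y2 H]]] _.
  have [/val_inj em i1 i2] := splits_uniq H H'; subst m'.
  have z1 := mem_closed y1' (seq_iso_sym i1).
  have z2 := mem_closed y2' (seq_iso_sym i2).
  have [[_ G1] T1 [F1 E1] N1 _] := mem_type y1.
  have [[_ G2] T2 [F2 E2] N2 _] := mem_type y2.
  have [[_ G1'] T1' [F1' E1'] N1' _] := mem_type z1.
  have [[_ G2'] T2' [F2' E2'] N2' _] := mem_type z2.
  have esp : sp = sp'.
    apply: splitting_eq; first [exact: (has_genus_uniq G1 G1')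
      | exact: (has_genus_uniq G2 G2') | congruence].
  subst sp'; have -> := mem_inj y1 z1.
  by have -> := mem_inj y2 z2.
- move=> [h' [i' [y' H' ei']]] [h [i [y H ei]]] _.
  have [eii ih] := splits_vertex_uniq H H'.
  have z := mem_closed y' (seq_iso_sym ih).
  have ep : p = p'.
    apply: int_range_eq.
    have [_ _ _ _ ed] := mem_type y; have [_ _ _ _ ed'] := mem_type z.
    by have := etrans (esym ed) ed' => -[].
  subst p'; have -> := mem_inj y z.
  by have -> : q = q' by apply: int_range_eq; rewrite ei ei' eii.
- move=> [h' [k' [y' H' ek']]] [h [k [y H ek]]] _.
  have z := mem_closed y' (seq_iso_sym (merges_unmarked_uniq H H')).
  have ep : p = p'.
    apply: int_range_eq; have [_ _ _ <- _] := mem_type y.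
    by have [_ _ _ -> _] := mem_type z.
  by subst p'; have -> := mem_inj y z.
move=> [h' [k' [y' H' ek']]] [h [k [y H ek]]] _.
have [/val_inj ej ih] := merges_marked_uniq H H'; subst j'.
by have -> := mem_inj y (mem_closed y' (seq_iso_sym ih)).
Qed.

Hypothesis pos : 0 < t -> 0 < n /\ all (fun d => 0 < d) D.

(** Positivity of the degrees is used in the merging cases: the number k of steps must
    be smaller than the degree of the root vertex of the piece, which is n + k or
    d_j + n - 1. *)
Lemma removes_onto d : exists2 s, has_type s g t f e n D & removes s d.
Proof.
case: d => [[[[[sp [m [x1 x2]]]|[p [x q]]]|[p x]]|[j x]]|[C [eC eD]]].
- have [s1 y1] := mem_exists x1; have [s2 y2] := mem_exists x2.
  have [[G1p G1] T1 [F1 E1] N1 D1] := mem_type y1.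
  have [[G2p G2] T2 [F2 E2] N2 D2] := mem_type y2.
  have sm : size m = size D by rewrite size_tuple.
  have c1 : count id m = size (smarked s1).
    by have := congr1 size D1; rewrite size_map marked_degreesE size_map size_mask.
  have c2 : count negb m = size (smarked s2).
    have := congr1 size D2; rewrite size_map marked_degreesE size_map size_mask.
      by move->; rewrite count_map; apply: eq_count.
    by rewrite size_map.
  have [M H] := splits_exists c1 c2; exists (NE M); last by exists s1, s2.
  have [[n1' n2' n3 n4 n5] [n6 n7 n8]] := splits_counts H.
  have eg := split_g sp; have et := split_t sp; have ee := split_e sp.
  have ef := split_f sp; have en := split_n sp.
  have hg := splits_genus H G1 G2.
  split; first by split; [lia | rewrite -eg].
  - lia.
  - by split; lia.
  - lia.
  rewrite -/(marked_degs M); apply: (mask_comask_inj (m := m)).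
  + by rewrite size_map n6.
  + by rewrite sm.
  + by rewrite -map_mask n7.
  by rewrite -map_comask n8.
- have [s y] := mem_exists x; have [[Gp G] T [F E] N DD] := mem_type y.
  case: s y Gp G T F E N DD => [|h] y Gp G T F E N DD //.
  case: q => q qp; have q1 : (`|q|.-1 < `|sval p|)%N.
    by case/andP: qp; lia.
  move: DD; rewrite /marked_degrees; case em : (marked h) => [|V vs] //= [Vp vsD].
  have iV : (`|q|.-1 < #|V|)%N by rewrite -Vp in q1.
  have [M H] := splits_vertex_exists em iV.
  exists (NE M); last first.
    by exists h, `|q|%N.-1; split=> //=; case/andP: qp; lia.
  have [c1 c2 c3 c4 [p' [c5 ip c6]]] := splits_vertex_counts H.
  have [ep' eDM] : p'%:Z = sval p /\ [seq d%:Z | d <- marked_degs M] = D.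
    move: c5; rewrite /marked_degs /= em /= => -[<- <-]; split=> //.
  split; first split; first by lia.
  - by apply/(splits_vertex_genus _ H).
  - lia.
  - by split; lia.
  - lia.
  exact: eDM.
- have [s y] := mem_exists x; have [[Gp G] T [F E] N DD] := mem_type y.
  have [p_n p_t] := andP (svalP p).
  have [n_gt0 _] : 0 < n /\ all (fun d => 0 < d) D by apply: pos; lia.
  case: s y Gp G T F E N DD => [|h] y Gp G T F E N DD.
    by rewrite /= in N; lia.
  pose k := `|sval p - n|%N.
  have kh : (k < root_degree (NE h))%N by lia.
  have [M H] := merges_unmarked_exists kh.
  have [[c1 c2 c3 c4 c5] c6] := merges_unmarked_counts H.
  exists (NE M); last by exists h, k; split=> //; rewrite /k; lia.
  split.
  - by split=> //; apply/(merges_unmarked_genus _ H).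
  - lia.
  - by split; lia.
  - lia.
  by rewrite -/(marked_degs M) -c6.
- have [s y] := mem_exists x; have [[Gp G] T [F E] N DD] := mem_type y.
  have [n_gt0 /allP Dpos] : 0 < n /\ all (fun d => 0 < d) D by apply: pos; lia.
  have [k Dk] : exists k : nat, D`_j = k.+1%:Z.
    have succ_pred (d : int) : 0 < d -> d = (`|d|.-1.+1)%:Z by lia.
    by exists (absz D`_j).-1; apply/succ_pred/Dpos/mem_nth.
  case: s y Gp G T F E N DD => [|h] y Gp G T F E N DD.
    by rewrite Dk /= in N; lia.
  rewrite Dk in N; have kh : (k < root_degree (NE h))%N by lia.
  have jh : (j <= size (marked h))%N.
    have := congr1 size DD; rewrite !size_map => ->.
    by rewrite -ltnS size_remove_nth.
  have [M H] := merges_marked_exists kh jh.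
  have [[c1 c2 c3 c4 c5] [c6 c7 c8]] := merges_marked_counts H.
  exists (NE M); last by exists h, k.
  split.
  - by split=> //; apply/(merges_marked_genus _ H).
  - lia.
  - by split; lia.
  - lia.
  rewrite -/(marked_degs M) -(insert_remove 0%N c6) map_insert -c7.
  by rewrite DD c8 -Dk insert_remove.
by exists EE => //; case: eD => -> -> -> -> -> ->.
Qed.

End Removal.

Theorem theorem3 :
  forall (g t f e n : int) (D : seq int),
    (0 < t -> 0 < n /\ all (fun d => 0 < d) D) ->
    exists F : hypermaps g t f e n D -> decomposition g t f e n D,
      bijective F.
Proof.
move=> g t f e n D pos.
have exF (x : hypermaps g t f e n D) :
    exists d : decomposition g t f e n D, exists2 s, sval x s & removes s d.
  have [s y] := mem_exists x; have [d rd] := removes_total (mem_type y).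
  by exists d, s.
have exG (d : decomposition g t f e n D) :
    exists x : hypermaps g t f e n D, exists2 s, sval x s & removes s d.
  have [s T rd] := removes_onto pos d; have [x y] := mem_make T.
  by exists x, s.
pose F x := sval (constructive_indefinite_description _ (exF x)).
pose G d := sval (constructive_indefinite_description _ (exG d)).
have FP x : exists2 s, sval x s & removes s (F x).
  exact: (svalP (constructive_indefinite_description _ (exF x))).
have GP d : exists2 s, sval (G d) s & removes s d.
  exact: (svalP (constructive_indefinite_description _ (exG d))).
exists F, G => [x|d].
  have [s y rx] := FP x; have [s' y' rx'] := GP (F x).
  exact: mem_inj (mem_closed y' (removes_inj rx' rx)) y.
have [s y rd] := GP d; have [s' y' rd'] := FP (G d).
exact: removes_det (removes_iso (mem_iso y' y) rd') rd.
Qed.
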